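(* Let $K$ be a non-archimedean local field of characteristic $p>0$, with ring of integers $\mathcal{O}_K$, uniformizer $\pi$, and residue field of cardinality $q$. Let $m\ge 2$ be an integer with $p\nmid m$, let $d$ be a nonnegative integer, and let $$h(x,y)=\mu_1x^d+\mu_2y^m+\pi h_0(x)\in\mathcal{O}_K[x,y],$$ where $\mu_1\in\mathcal{O}_K^{\times}$, $\mu_2\in\mathcal{O}_K$ with $\mu_2\neq 0$, and $h_0(x)\in\mathcal{O}_K[x]$ satisfies $\mathrm{ldeg}(h_0)\ge d+1$. Then for every multiplicative character $\chi$ of $\mathcal{O}_K^\times$ there are polynomials $H_1(x),H_2(x)\in\mathbb{C}[x]$ such that, for all $s\in\mathbb{C}$ with $\mathrm{Re}(s)>0$, $$Z_h(s,\chi)=\begin{cases}\dfrac{H_1(q^{-s})}{1-q^{-1-s}}, & \text{if } d\le 1,\\[2mm] \dfrac{H_2(q^{-s})}{(1-q^{-1-s})\bigl(1-q^{-\tilde d-\tilde m-\tilde d\tilde m\gcd(d,m)s}\bigr)}, & \text{otherwise,}\end{cases}$$ where $\tilde d=d/\gcd(d,m)$ and $\tilde m=m/\gcd(d,m)$.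
   Context: $\mathcal{O}_K^\times$ is the unit group of $\mathcal{O}_K$, $\mathcal{P}_K=\pi\mathcal{O}_K$ its maximal ideal, and $q=\#(\mathcal{O}_K/\mathcal{P}_K)$. For $x\in K^\times$, $\mathrm{ord}(x)$ is the valuation with $\mathrm{ord}(\pi)=1$, $x=ac(x)\pi^{\mathrm{ord}(x)}$ with $ac(x)\in\mathcal{O}_K^\times$ (the angular component), and $|x|=q^{-\mathrm{ord}(x)}$, $|0|=0$. $|dx|$ is the Haar measure on $K^n$ normalized so that $\mathcal{O}_K^n$ has measure $1$. For a multiplicative character $\chi:\mathcal{O}_K^\times\to\mathbb{C}^\times$ extended by $\chi(0)=0$, and $f\in\mathcal{O}_K[x_1,\dots,x_n]$, the Igusa local zeta function is $Z_f(s,\chi)=\int_{\mathcal{O}_K^n}\chi(ac\, f(x))|f(x)|^s|dx|$ for $\mathrm{Re}(s)>0$. For a one-variable polynomial $h=\sum_i a_ix^i$, $\mathrm{ldeg}(h)=\min\{i: a_i\ne 0\}$ if $h\neq 0$, and $\mathrm{ldeg}(0)=+\infty$. *)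

(* Defs.v *)
From HB Require Import structures.
From mathcomp Require Import all_boot all_order all_algebra.
From mathcomp Require Import finmap.
From mathcomp Require Import complex.
From mathcomp Require Import all_classical all_reals all_analysis.
(* The notations of mpoly clash with those of MathComp-Analysis. *)
From mathcomp Require Import -(notations) mpoly.

Set Implicit Arguments.
Unset Strict Implicit.
Unset Printing Implicit Defensive.

Import Order.TTheory GRing.Theory Num.Theory.
Import numFieldNormedType.Exports.

Local Open Scope classical_set_scope.
Local Open Scope ring_scope.
Local Open Scope complex_scope.

(* A non-archimedean local field: a field, complete for the topology of a
   discrete valuation [ord] onto Z, with finite residue field.  The value
   [ord 0] is irrelevant: the sets [x = 0 \/ N <= ord x] below are the powers
   P^N of the maximal ideal, and the residue field is the set of cosets
   x + P, for x in the valuation ring. *)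
HB.mixin Record isNonArchLocalField K of GRing.Field K & Uniform K := {
  ord : K -> int;
  ordM : forall x y : K, x != 0 -> y != 0 -> ord (x * y) = ord x + ord y;
  ordD : forall x y : K, x != 0 -> y != 0 -> x + y != 0 ->
    Order.min (ord x) (ord y) <= ord (x + y);
  ord_onto : exists x : K, x != 0 /\ ord x = 1;
  entourage_ord : @entourage K = filter_from [set: int] (fun N =>
    [set xy | xy.1 - xy.2 = 0 \/ N <= ord (xy.1 - xy.2)]);
  cauchy_complete : forall F : set_system K,
    ProperFilter F -> cauchy F -> exists x : K, F --> x;
  residue_finite : finite_set
    [set [set y : K | y - x = 0 \/ 1 <= ord (y - x)]
       | x in [set x : K | x = 0 \/ 0 <= ord x]]
}.

#[short(type="nonArchLocalFieldType")]
HB.structure Definition NonArchLocalField :=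
  {K of isNonArchLocalField K & GRing.Field K & Uniform K}.

Section LocalField.
Variable K : nonArchLocalFieldType.

Definition OK : set K := [set x | x = 0 \/ 0 <= ord x].
Definition PK : set K := [set x | x = 0 \/ 1 <= ord x].
Definition OKunit : set K := [set x | x != 0 /\ ord x = 0].

Definition uniformizer (pi : K) : Prop := pi != 0 /\ ord pi = 1.

Definition residue_field : set (set K) :=
  [set [set y : K | PK (y - x)] | x in OK].

Definition residue_card : nat := #|` fset_set residue_field|%fset.

(* [ac pi 0 = 0] *)
Definition ac (pi x : K) : K := x * pi ^ (- ord x).

Definition absK (R : realType) (x : K) : R :=
  if x == 0 then 0 else residue_card%:R ^ (- ord x).

HB.instance Definition _ := isPointed.Build K 0.

(* K^n with its Borel sigma-algebra. *)
Definition borelKn (n : nat) := g_sigma_algebraType (@open 'rV[K]_n).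

HB.instance Definition _ (n : nat) := Measurable.on (borelKn n).

Definition OKn (n : nat) : set (borelKn n) :=
  [set x : 'rV[K]_n | forall i, OK (x ord0 i)].

(* Together with translation invariance, mass 1 on O_K^n forces [mu] to be
   finite on compact sets, so [mu] is the normalized Haar measure. *)
Definition normalized_haar (R : realType) (n : nat)
    (mu : {measure set (borelKn n) -> \bar R}) : Prop :=
  (forall (a : 'rV[K]_n) (A : set (borelKn n)), measurable A ->
     mu [set (a + x : 'rV[K]_n) | x in A] = mu A) /\
  mu (@OKn n) = 1%E.

(* A continuous homomorphism from the unit group to C^*, extended by 0 at 0;
   its other values are never used.  [^o] gives C the topology of the norm. *)
Definition mult_char (R : realType) (chi : K -> R[i]) : Prop :=
  [/\ forall u v, OKunit u -> OKunit v -> chi (u * v) = chi u * chi v,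
      forall u, OKunit u -> chi u != 0,
      chi 0 = 0 &
      {within OKunit, continuous (chi : K -> (R[i])^o)}].

End LocalField.

(* a ^ s for a real a >= 0 and a complex s, with 0 ^ s = 0. *)
Definition cpow (R : realType) (a : R) (s : R[i]) : R[i] :=
  if a == 0 then 0
  else (expR (complex.Re s * ln a) * cos (complex.Im s * ln a))
       +i* (expR (complex.Re s * ln a) * sin (complex.Im s * ln a)).

Definition Cintegral d (T : measurableType d) (R : realType)
    (mu : {measure set T -> \bar R}) (D : set T) (f : T -> R[i]) : R[i] :=
  Rintegral mu D (fun x => complex.Re (f x)) +i* Rintegral mu D (fun x => complex.Im (f x)).

Definition igusa_zeta (K : nonArchLocalFieldType) (R : realType) (pi : K)
    (n : nat) (mu : {measure set (borelKn K n) -> \bar R})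
    (f : mpoly.mpoly n K) (chi : K -> R[i]) (s : R[i]) : R[i] :=
  Cintegral mu (@OKn K n) (fun x : 'rV[K]_n =>
    let fx := mpoly.meval (fun i => x ord0 i) f in
    chi (ac pi fx) * cpow (absK R fx) s).

Definition ldeg (K : fieldType) (p : {poly K}) : \bar int :=
  if p == 0 then +oo%E else ((find (fun a : K => a != 0) p)%:Z)%:E.

(* mu1 x^d + mu2 y^m + pi h0(x), as a polynomial in two variables. *)
Definition hpoly (K : fieldType) (pi mu1 mu2 : K) (d m : nat)
    (h0 : {poly K}) : mpoly.mpoly 2 K :=
  let X : mpoly.mpoly 2 K := mpoly.mpolyX K (mpoly.mnm1 (ord0 : 'I_2)) in
  let Y : mpoly.mpoly 2 K := mpoly.mpolyX K (mpoly.mnm1 (ord_max : 'I_2)) in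
  mu1 *: X ^+ d + mu2 *: Y ^+ m
    + pi *: (map_poly (@mpoly.mpolyC 2 K) h0).[X].

(* Main.v *)
Require Import Defs.
From mathcomp Require Import all_boot all_order all_algebra.
From mathcomp Require Import finmap complex zify ring lra.
From mathcomp Require Import all_classical all_reals all_analysis measurable_realfun.
From mathcomp Require Import -(notations) mpoly.

Set Implicit Arguments.
Unset Strict Implicit.
Unset Printing Implicit Defensive.

Import Order.TTheory GRing.Theory Num.Theory.
Import numFieldNormedType.Exports.

Local Open Scope classical_set_scope.
Local Open Scope ring_scope.

(* Expanding the integrand in powers of t = q^-s gives Z = sum_k c_k t^k, where c_k
   is the mean over O_K^2 of the locally constant function
   (x, y) |-> [ord h = k] chi(ac h).  Rationality of Z is then a linear recurrence
   for (c_k).  Write h = x^d u(x) + mu2 y^m with u a unit-valued function.  On the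
   region {ord x >= m~, ord y >= d~} rescaling turns h into pi^lcm(d, m) times a
   function of the same shape, with u(pi^m~ x) in place of u(x); off this region
   h = 0 is smooth in the direction of y and contributes a sequence that is
   eventually geometric of ratio q^-1.  After finitely many rescalings u is constant
   modulo the conductor of chi, and then c_k no longer depends on u, because one-units
   are m-th powers up to any precision.  This closes the recurrence.  For d = 1 the map
   x |-> x u(x) preserves the measure, and for d = 0 the whole curve is smooth. *)

(** * The valuation *)

(** Up to the measure, everything is finite: locally constant functions are averaged over O_K /
    P_K^n, and Haar measure enters through the mass q^(-2n) of a ball. No infinite series is formed
    either: partial sums are compared up to errors O(|t|^n), and a constant of that size is 0
    because |t| < 1. The condition that p does not divide m acts twice. It makes m a unit of O_K, so
    that x |-> ((1 + w x)^m - 1)/(m w) is an isometry for w in P_K and h becomes affine in a new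
    coordinate on small cosets of y away from 0. In characteristic p it also yields approximate m-th
    roots of one-units from Frobenius powers, without Hensel's lemma. The obstacle is that rescaling
    changes u, hence links two different series: Z_u = A_u + l t^L Z_v with v(x) = u(pi^m~ x), l =
    q^(-m~-d~), L = lcm(d, m). The remedy is to follow D_u = (1 - l t^L) Z_u, for which D_u = (1 - l
    t^L) A_u + l t^L D_v. As A_u has denominator 1 - q^-1 t, this property passes from D_v to D_u.
    The chain ends where u is constant modulo the conductor: there Z_v = Z_u and D_u = A_u. *)

Section Valuation.
Variable K : nonArchLocalFieldType.
Implicit Types x y z u v : K.

Lemma ord_mul x y : x != 0 -> y != 0 -> ord (x * y) = ord x + ord y.
Proof. exact: ordM. Qed.

Lemma ord_ultrametric x y : x != 0 -> y != 0 -> x + y != 0 ->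
  Num.min (ord x) (ord y) <= ord (x + y).
Proof. exact: ordD. Qed.

(** Membership in P_K^n. Since [ord 0] is arbitrary, comparisons go through this predicate, which
    puts 0 in every power. *)
Definition ordge (n : int) x : bool := (x == 0) || (n <= ord x).

Lemma ord1 : ord (1 : K) = 0.
Proof.
have := ord_mul (oner_neq0 K) (oner_neq0 K); rewrite mulr1 => h.
by set a := ord 1 in h *; lia.
Qed.

Lemma ordN x : ord (- x) = ord x.
Proof.
have N1 : (-1 : K) != 0 by rewrite oppr_eq0 oner_neq0.
have [->|x0] := eqVneq x 0; first by rewrite oppr0.
have := ord_mul N1 N1; rewrite mulrNN mulr1 ord1 => h.
rewrite -mulN1r ord_mul //; lia.
Qed.

Lemma ordX x n : x != 0 -> ord (x ^+ n) = ord x * n%:Z.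
Proof.
move=> x0; elim: n => [|n IH]; first by rewrite expr0 ord1 mulr0.
by rewrite exprS ord_mul ?expf_neq0 // IH; lia.
Qed.

Lemma ordV x : x != 0 -> ord x^-1 = - ord x.
Proof.
move=> x0; have := ord_mul x0 (invr_neq0 x0).
by rewrite divff // ord1; lia.
Qed.

Lemma ordge0 n : ordge n 0. Proof. by rewrite /ordge eqxx. Qed.

Lemma ordgeE n x : x != 0 -> ordge n x = (n <= ord x).
Proof. by rewrite /ordge => /negPf ->. Qed.

Lemma ordgeW m n x : m <= n -> ordge n x -> ordge m x.
Proof. by rewrite /ordge => mn /orP[->//|h]; rewrite (le_trans mn h) orbT. Qed.

Lemma ordgeN n x : ordge n (- x) = ordge n x.
Proof. by rewrite /ordge oppr_eq0 ordN. Qed.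

Lemma ordgeD n x y : ordge n x -> ordge n y -> ordge n (x + y).
Proof.
rewrite /ordge; have [->|x0] := eqVneq x 0; first by rewrite add0r.
have [->|y0] := eqVneq y 0; first by rewrite addr0 => /= ->; rewrite orbT.
have [//|xy0 /= hx hy] := eqVneq (x + y) 0.
by apply: le_trans (ord_ultrametric x0 y0 xy0); rewrite le_min hx hy.
Qed.

Lemma ordgeB n x y : ordge n x -> ordge n y -> ordge n (x - y).
Proof. by move=> hx hy; apply: ordgeD; rewrite ?ordgeN. Qed.

Lemma ordgeC n x y : ordge n (x - y) = ordge n (y - x).
Proof. by rewrite -ordgeN opprB. Qed.

Lemma ordgeDl n x y : ordge n y -> ordge n (x + y) = ordge n x.
Proof.
move=> hy; apply/idP/idP => [h|h]; last exact: ordgeD.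
by rewrite -[x](addrK y); apply: ordgeB.
Qed.

Lemma ordgeM a b x y : ordge a x -> ordge b y -> ordge (a + b) (x * y).
Proof.
rewrite /ordge mulf_eq0.
have [//|x0] := eqVneq x 0; have [//|y0 /= hx hy] := eqVneq y 0.
by rewrite ord_mul // lerD.
Qed.

Lemma ordgeMl n x y : ordge 0 x -> ordge n y -> ordge n (x * y).
Proof. by move=> hx hy; rewrite -[n]add0r; apply: ordgeM. Qed.

Lemma ordgeMr n x y : ordge n x -> ordge 0 y -> ordge n (x * y).
Proof. by move=> hx hy; rewrite -[n]addr0; apply: ordgeM. Qed.

Lemma ordgeX x n : ordge 0 x -> ordge 0 (x ^+ n).
Proof.
move=> hx; elim: n => [|n IH]; first by rewrite expr0 ordgeE ?oner_neq0 ?ord1.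
by rewrite exprS; apply: ordgeMl.
Qed.

Lemma ordge01 : ordge 0 (1 : K). Proof. by rewrite ordgeE ?oner_neq0 ?ord1. Qed.

Lemma ordge_sum (I : Type) (r : seq I) (P : pred I) (F : I -> K) n :
  (forall i, P i -> ordge n (F i)) -> ordge n (\sum_(i <- r | P i) F i).
Proof.
by move=> h; elim/big_ind: _ => [|x y|//]; [exact: ordge0 | exact: ordgeD].
Qed.

Lemma ordge_natr k : ordge 0 (k%:R : K).
Proof.
by rewrite -[k]card_ord -sumr_const; apply: ordge_sum => i _; exact: ordge01.
Qed.

Lemma ordge_unitM n u x : OKunit u -> ordge n (u * x) = ordge n x.
Proof.
move=> [u0 ou]; rewrite /ordge mulf_eq0 (negPf u0) /=.
by have [//|x0] := eqVneq x 0; rewrite ord_mul // ou add0r.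
Qed.

Lemma ord_addl x y n : x != 0 -> ord x < n -> ordge n y ->
  x + y != 0 /\ ord (x + y) = ord x.
Proof.
move=> x0 xn hy.
have h m : ord x < m -> ~~ ordge m x by move=> ?; rewrite ordgeE // -ltNge.
have xy0 : x + y != 0.
  apply/eqP => e; apply: (negP (h n xn)).
  have -> : x = - y by apply/eqP; rewrite -addr_eq0 e.
  by rewrite ordgeN.
split=> //; apply/eqP; rewrite eq_le; apply/andP; split.
- rewrite leNgt; apply/negP => lt.
  have lt' : ord x < Num.min (ord (x + y)) n by rewrite lt_min lt xn.
  apply: (negP (h _ lt')).
  have : ordge (Num.min (ord (x + y)) n) (x + y - y).
    apply: ordgeB; first by rewrite ordgeE // ge_min lexx.
    by apply: ordgeW hy; rewrite ge_min lexx orbT.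
  by rewrite addrK.
- have : ordge (ord x) (x + y).
    by apply: ordgeD; [rewrite ordgeE | apply: ordgeW hy; exact: ltW].
  by rewrite ordgeE.
Qed.

Lemma OK_ordge x : OK x <-> ordge 0 x.
Proof.
by split=> [[->|h]|/orP[/eqP|]]; [exact: ordge0|apply/orP; right|left|right].
Qed.

Lemma PK_ordge x : PK x <-> ordge 1 x.
Proof.
by split=> [[->|h]|/orP[/eqP|]]; [exact: ordge0|apply/orP; right|left|right].
Qed.

Lemma OKunit_ordge u : OKunit u -> ordge 0 u.
Proof. by move=> [u0 ou]; rewrite ordgeE // ou. Qed.

Lemma OKunitM u v : OKunit u -> OKunit v -> OKunit (u * v).
Proof.
by move=> [u0 ou] [v0 ov]; split; rewrite ?mulf_neq0 // ord_mul // ou ov.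
Qed.

Lemma OKunitV u : OKunit u -> OKunit u^-1.
Proof. by move=> [u0 ou]; split; rewrite ?invr_neq0 // ordV // ou. Qed.

Lemma OKunit1 : OKunit (1 : K). Proof. by split; rewrite ?oner_neq0 ?ord1. Qed.

Lemma OKunitX u n : OKunit u -> OKunit (u ^+ n).
Proof.
move=> hu; elim: n => [|n IH]; first exact: OKunit1.
by rewrite exprS; apply: OKunitM.
Qed.

Lemma OKunit_near u v : OKunit u -> ordge 1 (v - u) -> OKunit v.
Proof.
move=> [u0 ou] h; have [|v0 ov] := ord_addl u0 _ h; first by rewrite ou.
by move: v0 ov; rewrite addrC subrK ou; split.
Qed.


End Valuation.

(** * Representatives of the residue field *)

Section Residues.
Variable K : nonArchLocalFieldType.

(** The residue field is given as a set of cosets, so one point is chosen in each; nothing forces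
    the class of 0 to be represented by 0. *)
Definition residues : seq K :=
  [seq xget (0 : K) c | c <- fset_set (@residue_field K)].

Lemma size_residues : size residues = residue_card K.
Proof. by rewrite size_map. Qed.

Lemma finite_residue_field : finite_set (@residue_field K).
Proof. exact: residue_finite. Qed.

Lemma residue_classP (c : set K) : c \in fset_set (@residue_field K) ->
  exists2 x, ordge 0 x & forall y, c y <-> ordge 1 (y - x).
Proof.
rewrite in_fset_set; last exact: finite_residue_field.
rewrite inE => -[x /OK_ordge hx <-]; exists x => // y.
exact: PK_ordge.
Qed.

Lemma residue_class_repr (c : set K) : c \in fset_set (@residue_field K) ->
  ordge 0 (xget (0 : K) c) /\ forall y, c y <-> ordge 1 (y - xget (0 : K) c).
Proof.
move=> /residue_classP[x hx hc].
have cx : c x by apply/hc; rewrite subrr ordge0.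
have : c (xget (0 : K) c) by exact: xgetPex (ex_intro _ x cx).
move=> /hc h; split.
  rewrite -[xget _ _](subrK x); apply: ordgeD => //; exact: ordgeW h.
move=> y; rewrite hc.
rewrite -[X in _ <-> ordge 1 X](subrKA x) (ordgeDl (y - x)) //.
by rewrite ordgeC.
Qed.

Lemma residues_ordge0 r : r \in residues -> ordge 0 r.
Proof. by move=> /mapP[c /residue_class_repr[h _] ->]. Qed.

Lemma residues_inj : {in residues &, forall r r', ordge 1 (r - r') -> r = r'}.
Proof.
move=> _ _ /mapP[c hc ->] /mapP[c' hc' ->] h; congr (xget _ _).
have [_ h1] := residue_class_repr hc; have [_ h2] := residue_class_repr hc'.
apply/seteqP; split=> y.
- move=> /h1 hy; apply/h2.
  by rewrite -(subrKA (xget (0 : K) c)); apply: ordgeD.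
- move=> /h2 hy; apply/h1.
  by rewrite -(subrKA (xget (0 : K) c')); apply: ordgeD; rewrite // ordgeC.
Qed.

Lemma uniq_residues : uniq residues.
Proof.
rewrite map_inj_in_uniq ?fset_uniq // => c c' hc hc' e.
have [_ h1] := residue_class_repr hc; have [_ h2] := residue_class_repr hc'.
by apply/seteqP; split=> y;
  [move=> /h1; rewrite e => /h2 | move=> /h2; rewrite -e => /h1].
Qed.

Lemma residuesP x : ordge 0 x -> exists2 r, r \in residues & ordge 1 (x - r).
Proof.
move=> hx; set c := [set y : K | PK (y - x)].
have hc : c \in fset_set (@residue_field K).
  rewrite in_fset_set; last exact: finite_residue_field.
  by rewrite inE; exists x => //; exact/OK_ordge.
exists (xget (0 : K) c); first by apply/mapP; exists c.
have [_ /(_ x)[h _]] := residue_class_repr hc.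
by apply: h; apply/PK_ordge; rewrite subrr ordge0.
Qed.

Lemma residue_card_gt1 : (1 < residue_card K)%N.
Proof.
have [r hr h] := residuesP (ordge0 K 0).
have [r' hr' h'] := residuesP (ordge01 K).
rewrite -size_residues.
have rr' : r != r'.
  apply/eqP => e; move: h h'; rewrite -e sub0r ordgeN => h.
  by rewrite ordgeDl ?ordgeN // ordgeE ?oner_neq0 // ord1.
have: (size [:: r; r'] <= size residues)%N.
  by apply: uniq_leq_size => [|z]; rewrite /= ?inE ?rr' // => /orP[]/eqP->.
by [].
Qed.

End Residues.

(** * Means of locally constant functions *)

Section Average.
Variables (K : nonArchLocalFieldType) (pi : K) (hpi : uniformizer pi).
Variable C : numFieldType.
Implicit Types (x y z : K) (f g : K -> C) (F : K -> K -> C).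

Local Notation q := ((residue_card K)%:R : C).

Lemma pi_neq0 : pi != 0. Proof. exact: hpi.1. Qed.

Lemma piX_neq0 n : pi ^+ n != 0. Proof. by rewrite expf_neq0 // pi_neq0. Qed.

Lemma ord_piX (n : nat) : ord (pi ^+ n) = n.
Proof. by rewrite ordX ?pi_neq0 // hpi.2 mul1r. Qed.

Lemma ordge_piX (n : nat) : ordge n (pi ^+ n).
Proof. by rewrite ordgeE ?piX_neq0 // ord_piX. Qed.

Lemma ordge_piM (j : nat) (n : int) x : ordge n (pi ^+ j * x) = ordge (n - j%:Z) x.
Proof.
rewrite /ordge mulf_eq0 (negPf (piX_neq0 j)) /=.
have [//|x0] := eqVneq x 0; rewrite ord_mul ?piX_neq0 // ord_piX.
by rewrite lerBlDl.
Qed.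

Lemma ordge0_pi : ordge 0 pi. Proof. by rewrite ordgeE ?pi_neq0 // hpi.2. Qed.

Lemma ordge_pi1M (n : int) x : ordge n (pi * x) = ordge (n - 1) x.
Proof. by rewrite -[pi]expr1 ordge_piM. Qed.

Lemma ordge_pi_div (n : int) x : ordge n (x / pi) = ordge (n + 1) x.
Proof.
have {2}<- : pi * (x / pi) = x by rewrite mulrC divfK ?pi_neq0.
by rewrite ordge_pi1M addrK.
Qed.

Lemma q_neq0 : q != 0.
Proof. by rewrite pnatr_eq0 -lt0n (ltn_trans _ (residue_card_gt1 K)). Qed.

Definition residue x : K := xget 0 [set r | r \in residues K /\ ordge 1 (x - r)].

Lemma residueP x : ordge 0 x -> residue x \in residues K /\ ordge 1 (x - residue x).
Proof.
move=> /residuesP[r hr h].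
pose A := [set r | r \in residues K /\ ordge 1 (x - r)].
by have := xgetPex (0 : K) (ex_intro A r (conj hr h)).
Qed.

(* The mean of the values of [f] on representatives of O_K / P_K^n; the recursion on
   the first pi-adic digit is what makes invariance under isometries an induction. *)
Fixpoint average n f : C := if n is n'.+1
  then q^-1 * \sum_(r <- residues K) average n' (fun x => f (r + pi * x))
  else f 0.

(** The functions that factor through O_K / P_K^n. *)
Definition level n f := forall x y, ordge 0 x -> ordge 0 y ->
  ordge n%:Z (x - y) -> f x = f y.

(** Such a map induces an injection, hence a bijection, of each finite quotient O_K / P_K^n; this is
    why it preserves means. *)
Definition isometric (phi : K -> K) := (forall x, ordge 0 x -> ordge 0 (phi x)) /\
  forall x y (j : nat), ordge 0 x -> ordge 0 y ->
    ordge j (phi x - phi y) = ordge j (x - y).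

Lemma ordge_affine r x : r \in residues K -> ordge 0 x -> ordge 0 (r + pi * x).
Proof.
move=> /residues_ordge0 hr hx; apply: ordgeD => //.
by rewrite ordge_pi1M; apply: ordgeW hx.
Qed.

Lemma level_affine n f r : level n.+1 f -> r \in residues K ->
  level n (fun x => f (r + pi * x)).
Proof.
move=> hf hr x y hx hy h; apply: hf; rewrite ?ordge_affine //.
rewrite addrAC opprD addrA subrr add0r addrC -mulrBr ordge_pi1M.
by move: h; congr ordge; lia.
Qed.

Lemma levelW m n f : (m <= n)%N -> level m f -> level n f.
Proof.
by move=> mn hf x y hx hy h; apply: hf => //; apply: ordgeW h; rewrite lez_nat.
Qed.

Lemma eq_average n f g : (forall x, ordge 0 x -> f x = g x) -> average n f = average n g.
Proof.
elim: n f g => [|n IH] f g h /=; first by rewrite h // ordge0.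
congr (_ * _); rewrite big_seq_cond [RHS]big_seq_cond; apply: eq_bigr => r.
by rewrite andbT => hr; apply: IH => x hx; apply: h; exact: ordge_affine.
Qed.

Lemma averageD n f g : average n (fun x => f x + g x) = average n f + average n g.
Proof.
elim: n f g => [|n IH] f g //=.
by rewrite -mulrDr -big_split /=; congr (_ * _); apply: eq_bigr => r _; rewrite IH.
Qed.

Lemma averageZ n a f : average n (fun x => a * f x) = a * average n f.
Proof.
elim: n f => [|n IH] f //=.
by rewrite mulrCA; congr (_ * _); rewrite mulr_sumr; apply: eq_bigr => r _; rewrite IH.
Qed.

Lemma average_cst n a : average n (fun=> a) = a.
Proof.
elim: n => [|n IH] //=.
rewrite (eq_bigr (fun=> a)) // big_const_seq count_predT iter_addr addr0.
by rewrite size_residues -[a *+ _]mulr_natl mulrA mulVf ?mul1r // q_neq0.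
Qed.

Lemma average_level n m f : level n f -> (n <= m)%N -> average m f = average n f.
Proof.
elim: n m f => [|n IH] m f hf.
  move=> _ /=; rewrite -[RHS](average_cst m); apply: eq_average => x hx.
  by apply: hf; rewrite ?subr0 ?ordge0.
case: m => // m nm /=; congr (_ * _).
rewrite big_seq_cond [RHS]big_seq_cond; apply: eq_bigr => r.
by rewrite andbT => hr; apply: IH => //; exact: level_affine.
Qed.

(** Modulo P_K, [phi] permutes the finitely many classes, being injective on them. On one class,
    subtracting the representative of the image and dividing by [pi] gives an isometric map again,
    to which the induction hypothesis applies. *)
Lemma average_isometric n f phi : level n f -> isometric phi ->
  average n (fun x => f (phi x)) = average n f.
Proof.
elim: n f phi => [|n IH] f phi hf [phi0 hphi] /=.
  by apply: hf; rewrite ?subr0 ?phi0 ?ordge0.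
congr (_ * _); pose G s := average n (fun x => f (s + pi * x)).
have res0 r : r \in residues K -> ordge 0 (phi r).
  by move=> /residues_ordge0; exact: phi0.
transitivity (\sum_(r <- residues K) G (residue (phi r))).
  rewrite big_seq_cond [RHS]big_seq_cond; apply: eq_bigr => r.
  rewrite andbT => hr; have [hs hs1] := residueP (res0 _ hr).
  set s := residue _ in hs hs1 *.
  pose psi x := (phi (r + pi * x) - s) / pi.
  have hr0 := residues_ordge0 hr.
  rewrite /G -(IH (fun x => f (s + pi * x)) psi).
  - apply: eq_average => x hx.
    by rewrite /psi [pi * (_ / _)]mulrC divfK ?pi_neq0 // [s + _]addrC subrK.
  - exact: level_affine.
  - split=> [x hx|x y j hx hy].
      rewrite /psi ordge_pi_div add0r -(subrKA (phi r)) ordgeDl //.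
      rewrite (hphi _ _ 1%N) ?ordge_affine // addrAC subrr add0r.
      by rewrite ordge_pi1M.
    rewrite /psi -mulrBl ordge_pi_div opprB addrA subrK.
    have -> : j%:Z + 1 = j.+1 by lia.
    rewrite hphi ?ordge_affine // opprD addrACA subrr add0r -mulrBr ordge_pi1M.
    by congr ordge; lia.
rewrite -/G -[LHS]/(\sum_(r <- residues K) G ((residue \o phi) r)).
rewrite -(big_map (residue \o phi) xpredT G); apply: perm_big.
have inj : {in residues K &, injective (residue \o phi)}.
  move=> r r' hr hr' /= e; apply: residues_inj => //.
  have [_ h] := residueP (res0 _ hr); have [_ h'] := residueP (res0 _ hr').
  rewrite -(hphi _ _ 1%N) ?residues_ordge0 // -(subrKA (residue (phi r))) ordgeD //.
  by rewrite ordgeC e.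
have u : uniq (map (residue \o phi) (residues K)).
  by rewrite map_inj_in_uniq // uniq_residues.
apply: uniq_perm => //; first exact: uniq_residues.
have sub : {subset map (residue \o phi) (residues K) <= residues K}.
  by move=> _ /mapP[r hr ->]; have [] := residueP (res0 _ hr).
by have [|_ e] := uniq_min_size u sub; rewrite ?size_map.
Qed.

(** Truncated [pi]-adic expansions with digits in [residues]: one point of each class of O_K /
    P_K^n. *)
Fixpoint representatives n : seq K := if n is n'.+1
  then [seq r + pi * x | r <- residues K, x <- representatives n'] else [:: 0].

Lemma representatives_ordge0 n x : x \in representatives n -> ordge 0 x.
Proof.
elim: n x => [|n IH] x /=; first by rewrite inE => /eqP ->; rewrite ordge0.
by move=> /allpairsP[[r y] /= [hr /IH hy ->]]; exact: ordge_affine.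
Qed.

Lemma representativesP n w : ordge 0 w ->
  exists2 x, x \in representatives n & ordge n%:Z (w - x).
Proof.
elim: n w => [|n IH] w hw; first by exists 0; rewrite ?inE ?subr0.
have [r hr h] := residuesP hw.
have [|y hy hy'] := IH ((w - r) / pi); first by rewrite ordge_pi_div.
exists (r + pi * y); first by apply/allpairsP; exists (r, y).
have -> : w - (r + pi * y) = pi * ((w - r) / pi - y).
  by field; exact: pi_neq0.
by rewrite ordge_pi1M; apply: ordgeW hy'; lia.
Qed.

Lemma representatives_inj n : {in representatives n &, forall x x',
  ordge n%:Z (x - x') -> x = x'}.
Proof.
elim: n => [|n IH] x x'; first by rewrite !inE => /eqP -> /eqP ->.
move=> /allpairsP[[r y] /= [hr hy ->]] /allpairsP[[r' y'] /= [hr' hy' ->]] h.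
have y0 := representatives_ordge0 hy; have y0' := representatives_ordge0 hy'.
have e : r + pi * y - (r' + pi * y') = (r - r') + pi * (y - y') by ring.
have rr' : r = r'.
  apply: residues_inj => //; move: h; rewrite e => h.
  rewrite -(ordgeDl (r - r') (y := pi * (y - y'))); first by apply: ordgeW h; lia.
  by rewrite ordge_pi1M; exact: ordgeB.
move: h; rewrite e rr' subrr add0r ordge_pi1M => h.
by congr (_ + _ * _); apply: IH => //; apply: ordgeW h; lia.
Qed.

Lemma uniq_representatives n : uniq (representatives n).
Proof.
elim: n => [|n IH] //=; apply: allpairs_uniq => //; first exact: uniq_residues.
move=> _ _ /allpairsP[[r y] /= [hr hy ->]] /allpairsP[[r' y'] /= [hr' hy' ->]] /= e.
have /representatives_ordge0 y0 := hy; have /representatives_ordge0 y0' := hy'.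
have rr' : r = r'.
  apply: residues_inj => //; have -> : r - r' = pi * (y' - y).
    by apply: (addIr (pi * y)); rewrite addrAC e; ring.
  by rewrite ordge_pi1M; apply: ordgeB.
by move: e; rewrite rr' => /addrI/(mulfI pi_neq0) ->.
Qed.

Lemma size_representatives n : size (representatives n) = (residue_card K ^ n)%N.
Proof.
by elim: n => [|n IH] //=; rewrite size_allpairs IH size_residues expnS.
Qed.

Lemma average_split m n f : average (m + n) f =
  q^-1 ^+ m * \sum_(x <- representatives m) average n (fun y => f (x + pi ^+ m * y)).
Proof.
elim: m f => [|m IH] f.
  rewrite expr0 mul1r big_seq1 add0n; apply: eq_average => x hx.
  by rewrite add0r expr0 mul1r.
rewrite /= exprS -mulrA; congr (_ * _).
rewrite big_allpairs_dep mulr_sumr; apply: eq_bigr => r _.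
rewrite IH; congr (_ * _); apply: eq_bigr => x _; apply: eq_average => y hy.
by congr f; rewrite exprS; ring.
Qed.

Lemma averageE n f : average n f = q^-1 ^+ n * \sum_(x <- representatives n) f x.
Proof.
rewrite -[in LHS](addn0 n) average_split; congr (_ * _); apply: eq_bigr => x _ /=.
by rewrite mulr0 addr0.
Qed.

Definition loc_const f := exists n, level n f.

(* A junk value unless [f] is locally constant. *)
Definition mean f : C := average (xget 0%N [set n | level n f]) f.

Lemma mean_level n f : level n f -> mean f = average n f.
Proof.
move=> hf; rewrite /mean.
have := xgetPex 0%N (ex_intro [set n | level n f] n hf).
set k := xget _ _ => /= hk; case: (leqP n k) => [|/ltnW] kn.
  by rewrite (average_level hf).
by rewrite (average_level hk kn).
Qed.

Lemma eq_mean f g : loc_const g -> (forall x, ordge 0 x -> f x = g x) -> mean f = mean g.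
Proof.
move=> [n hg] e; rewrite (mean_level hg) (@mean_level n) ; first exact: eq_average.
by move=> x y hx hy h; rewrite !e //; exact: hg.
Qed.

Lemma loc_const2 f g : loc_const f -> loc_const g ->
  exists n, level n f /\ level n g.
Proof.
move=> [n hf] [m hg]; exists (maxn n m); split.
  exact: levelW (leq_maxl _ _) hf.
exact: levelW (leq_maxr _ _) hg.
Qed.

Lemma loc_const_cst a : loc_const (fun=> a).
Proof. by exists 0%N. Qed.

Lemma loc_const_isometric f phi : loc_const f -> isometric phi ->
  loc_const (fun x => f (phi x)).
Proof.
move=> [n hf] [phi0 hphi]; exists n => x y hx hy h.
by apply: hf; rewrite ?phi0 // hphi.
Qed.

Lemma loc_const_scale a b f : ordge 0 a -> ordge 0 b -> loc_const f ->
  loc_const (fun x => f (a + b * x)).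
Proof.
move=> ha hb [n hf]; exists n => x y hx hy h.
apply: hf; [by rewrite ordgeD ?ordgeMl | by rewrite ordgeD ?ordgeMl |].
by rewrite opprD addrACA subrr add0r -mulrBr ordgeMl.
Qed.

Lemma meanD f g : loc_const f -> loc_const g ->
  mean (fun x => f x + g x) = mean f + mean g.
Proof.
move=> hf hg; have [n [lf lg]] := loc_const2 hf hg.
rewrite (mean_level lf) (mean_level lg) (@mean_level n) ?averageD //.
by move=> x y hx hy h; rewrite (lf x y) // (lg x y).
Qed.

Lemma meanZ a f : loc_const f -> mean (fun x => a * f x) = a * mean f.
Proof.
move=> [n lf]; rewrite (mean_level lf) (@mean_level n) ?averageZ //.
by move=> x y hx hy h; rewrite (lf x y).
Qed.

Lemma mean_cst a : mean (fun=> a) = a.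
Proof. by rewrite (@mean_level 0%N) ?average_cst. Qed.

Lemma mean_isometric f phi : loc_const f -> isometric phi ->
  mean (fun x => f (phi x)) = mean f.
Proof.
move=> [n lf] h; rewrite (mean_level lf) (@mean_level n) ?average_isometric //.
by case: h => phi0 hphi x y hx hy h; apply: lf; rewrite ?phi0 // hphi.
Qed.

Lemma isometric_add a : ordge 0 a -> isometric (fun x => x + a).
Proof.
move=> ha; split=> [x hx|x y j hx hy]; first exact: ordgeD.
by rewrite opprD addrACA subrr addr0.
Qed.

Lemma isometric_unit u : OKunit u -> isometric (fun x => u * x).
Proof.
move=> hu; split=> [x hx|x y j hx hy]; first by rewrite ordge_unitM.
by rewrite -mulrBr ordge_unitM.
Qed.

Lemma mean_split m f : loc_const f -> mean f =
  q^-1 ^+ m * \sum_(x <- representatives m) mean (fun y => f (x + pi ^+ m * y)).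
Proof.
move=> [n lf]; rewrite (@mean_level (m + n)) ?average_split; last first.
  by apply: levelW lf; rewrite leq_addl.
congr (_ * _); rewrite big_seq_cond [RHS]big_seq_cond; apply: eq_bigr => x.
rewrite andbT => /representatives_ordge0 hx; rewrite (@mean_level n) //.
have hp : ordge 0 (pi ^+ m) by apply: ordgeW (ordge_piX m).
move=> y z hy hz h; apply: lf; [by rewrite ordgeD ?ordgeMl | by rewrite ordgeD ?ordgeMl |].
by rewrite opprD addrACA subrr add0r -mulrBr ordgeMl.
Qed.

Lemma mean_supp_pi f : loc_const f -> (forall x, ordge 0 x -> ~~ ordge 1 x -> f x = 0) ->
  mean f = q^-1 * mean (fun x => f (pi * x)).
Proof.
move=> lf f0; rewrite (mean_split 1) // expr1; congr (_ * _).
have lfp : loc_const (fun x => f (pi * x)).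
  have [n hn] := loc_const_scale (ordge0 K 0) ordge0_pi lf.
  by exists n => x y hx hy h; have := hn x y hx hy h; rewrite !add0r.
rewrite big_allpairs_dep.
(* The representative [r] of the class of 0 may differ from 0; the translation by [r / pi], an
   isometry of O_K, absorbs it. *)
have [r hr h] := residuesP (ordge0 K 0).
rewrite sub0r ordgeN in h.
rewrite (bigD1_seq r) //= ?uniq_residues //= big_seq1 mulr0 addr0.
rewrite [X in _ + X]big1_seq ?addr0 => [|r' /andP[rr' hr']].
  have hrp : ordge 0 (r / pi) by rewrite ordge_pi_div.
  rewrite -[RHS](mean_isometric lfp (isometric_add hrp)).
  apply: eq_mean => [|x hx].
    exact: loc_const_isometric lfp (isometric_add hrp).
  by congr f; rewrite expr1 mulrDr [in RHS]mulrCA divff ?pi_neq0 // mulr1 addrC.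
rewrite big_seq1 mulr0 addr0.
rewrite -[RHS](mean_cst 0); apply: eq_mean => [|x hx]; first exact: loc_const_cst.
have hr0 := residues_ordge0 hr'.
have hpx : ordge 1 (pi * x) by rewrite ordge_pi1M.
apply: f0; rewrite expr1; first exact: ordge_affine.
rewrite ordgeDl //; apply: contra rr' => h'; apply/eqP; apply: residues_inj => //.
exact: ordgeB.
Qed.

Lemma mean_supp_piX n f : loc_const f ->
  (forall x, ordge 0 x -> ~~ ordge n%:Z x -> f x = 0) ->
  mean f = q^-1 ^+ n * mean (fun x => f (pi ^+ n * x)).
Proof.
elim: n f => [|n IH] f lf f0.
  by rewrite expr0 mul1r; apply: eq_mean => [|x hx]; rewrite ?expr0 ?mul1r //;
    case: lf => k lf; exists k => x y hx hy h; rewrite !mul1r; exact: lf.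
rewrite mean_supp_pi //; last first.
  by move=> x hx h; apply: f0 => //; apply: contra h; apply: ordgeW.
have lfp k : loc_const (fun x => f (pi ^+ k * x)).
  have hp : ordge 0 (pi ^+ k) by apply: ordgeW (ordge_piX k).
  have [m hm] := loc_const_scale (ordge0 K 0) hp lf.
  by exists m => x y hx hy h; have := hm x y hx hy h; rewrite !add0r.
rewrite IH.
- rewrite exprS mulrA; congr (_ * _); apply: eq_mean => [|x hx]; first exact: lfp.
  by rewrite mulrA -exprS.
- by have := lfp 1%N; rewrite expr1.
- move=> x hx h; apply: f0; first by rewrite ordge_pi1M; apply: ordgeW hx.
  by apply: contra h; rewrite ordge_pi1M; congr ordge; lia.
Qed.

(** * Functions of two variables *)

Definition level2 n F := forall x x' y y', ordge 0 x -> ordge 0 x' ->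
  ordge 0 y -> ordge 0 y' -> ordge n%:Z (x - x') -> ordge n%:Z (y - y') ->
  F x y = F x' y'.

Lemma level2l n F x : level2 n F -> ordge 0 x -> level n (F x).
Proof. by move=> hF hx y y' hy hy' h; apply: hF; rewrite ?subrr ?ordge0. Qed.

Lemma level2_mean n F : level2 n F -> level n (fun x => mean (F x)).
Proof.
move=> hF x y hx hy h; rewrite !(@mean_level n) ; try exact: level2l.
by apply: eq_average => z hz; apply: hF => //; rewrite subrr ordge0.
Qed.

Lemma mean2E n F : level2 n F -> mean (fun x => mean (F x)) =
  q^-1 ^+ n * (q^-1 ^+ n *
    \sum_(x <- representatives n) \sum_(y <- representatives n) F x y).
Proof.
move=> hF; rewrite (mean_level (level2_mean hF)) averageE.
congr (_ * _); rewrite mulr_sumr big_seq_cond [RHS]big_seq_cond; apply: eq_bigr => x.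
rewrite andbT => /representatives_ordge0 hx.
by rewrite (mean_level (level2l hF hx)) averageE.
Qed.

(** At a finite level, Fubini is the exchange of two finite sums. *)
Lemma mean_swap n F : level2 n F ->
  mean (fun x => mean (F x)) = mean (fun y => mean (fun x => F x y)).
Proof.
move=> hF; rewrite (mean2E hF) (@mean2E n) => [|x x' y y' hx hx' hy hy' h h'].
  by rewrite exchange_big.
exact: hF.
Qed.

End Average.

(** * The coefficients of the integrand *)

Section AngularCoefficients.
Variables (K : nonArchLocalFieldType) (pi : K) (hpi : uniformizer pi).
Implicit Types x y z w u v : K.

Lemma piZ_neq0 (n : int) : pi ^ n != 0.
Proof. by rewrite expfz_neq0 // (pi_neq0 hpi). Qed.

Lemma ord_piZ (n : int) : ord (pi ^ n) = n.
Proof.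
case: n => n; first by rewrite -exprnP ord_piX.
by rewrite NegzE -exprnN ordV ?piX_neq0 // ord_piX.
Qed.

Lemma ac_unit w : w != 0 -> OKunit (ac pi w).
Proof.
move=> w0; split; first by rewrite mulf_neq0 // piZ_neq0.
by rewrite ord_mul ?piZ_neq0 // ord_piZ addrN.
Qed.

Lemma acM x y : x != 0 -> y != 0 -> ac pi (x * y) = ac pi x * ac pi y.
Proof.
by move=> x0 y0; rewrite /ac ord_mul // opprD expfzDr ?(pi_neq0 hpi) // mulrACA.
Qed.

Lemma ac_of_unit u : OKunit u -> ac pi u = u.
Proof. by move=> [_ ou]; rewrite /ac ou oppr0 expr0z mulr1. Qed.

Lemma ac_piX n : ac pi (pi ^+ n) = 1.
Proof. by rewrite /ac ord_piX // -exprnN divff // piX_neq0. Qed.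

Variables (C : numFieldType) (chi : K -> C) (c : nat).
Hypothesis c_gt0 : (0 < c)%N.
Hypothesis chiM : forall u v, OKunit u -> OKunit v -> chi (u * v) = chi u * chi v.
Hypothesis chi1 : forall u, OKunit u -> ordge c (u - 1) -> chi u = 1.

Local Notation q := ((residue_card K)%:R : C).
Local Notation mean := (mean pi (C := C)).

(* The coefficient of q^(-ks) in chi(ac w)|w|^s. *)
Definition char_coef (k : nat) w : C :=
  if (w != 0) && (ord w == k%:Z) then chi (ac pi w) else 0.
Local Notation g := char_coef.

Lemma char_coef_unitM k u w : OKunit u -> g k (u * w) = chi u * g k w.
Proof.
move=> hu; rewrite /g mulf_eq0 (negPf hu.1) /=.
have [->|w0] /= := eqVneq w 0; first by rewrite mulr0.
rewrite ord_mul ?hu.1 // hu.2 add0r; case: ifP => _; last by rewrite mulr0.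
by rewrite acM ?hu.1 // ac_of_unit // chiM //; exact: ac_unit.
Qed.

Lemma char_coef_one_unitM k u w : OKunit u -> ordge c (u - 1) -> g k (u * w) = g k w.
Proof. by move=> hu h; rewrite char_coef_unitM // chi1 // mul1r. Qed.

Lemma char_coef_ordge (k : nat) w : ordge k.+1 w -> g k w = 0.
Proof.
rewrite /g; case: ifP => // /andP[w0 /eqP e]; rewrite ordgeE // e.
by rewrite lez_nat ltnn.
Qed.

Lemma char_coef_ord k w : ord w != k%:Z -> g k w = 0.
Proof. by rewrite /g => /negPf ->; rewrite andbF. Qed.

(** If w has valuation k, then w'/w lies in 1 + P_K^c, where [chi] is trivial; c > 0 ensures that
    this quotient is a unit. *)
Lemma char_coef_cong k w w' : ordge (k + c)%N (w - w') -> g k w = g k w'.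
Proof.
have main v v' : v != 0 -> ord v = k -> ordge (k + c)%N (v - v') -> g k v = g k v'.
  move=> v0 ov h.
  have h1 : ordge c (v' / v - 1).
    have -> : v' / v - 1 = (v' - v) * v^-1 by field.
    have -> : c%:Z = (k + c)%N%:Z + (- k%:Z) by lia.
    apply: ordgeM; first by rewrite ordgeC.
    by rewrite ordgeE ?invr_eq0 // ordV // ov.
  rewrite -[v'](divfK v0) char_coef_one_unitM //.
  apply: OKunit_near (OKunit1 K) _; apply: ordgeW h1; lia.
move=> h; have [/andP[w0 /eqP ow]|nw] := boolP ((w != 0) && (ord w == k%:Z)).
  exact: main.
have [/andP[w0 /eqP ow]|nw'] := boolP ((w' != 0) && (ord w' == k%:Z)).
  by apply/esym/main => //; rewrite ordgeC.
by rewrite /g (negPf nw) (negPf nw').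
Qed.

Lemma char_coef_piX k j w : g (k + j) (pi ^+ j * w) = g k w.
Proof.
rewrite /g mulf_eq0 (negPf (piX_neq0 hpi j)) /=.
have [//|w0] /= := eqVneq w 0.
rewrite ord_mul ?piX_neq0 // ord_piX // acM ?piX_neq0 // ac_piX mul1r.
by rewrite PoszD [_ + j%:Z]addrC (inj_eq (addrI _)).
Qed.

Lemma level_char_coef n k (f : K -> K) :
  (forall x y, ordge 0 x -> ordge 0 y -> ordge n%:Z (x - y) ->
    ordge (k + c)%N (f x - f y)) -> level n (fun x => g k (f x)).
Proof. by move=> h x y hx hy xy; apply: char_coef_cong; exact: h. Qed.

Lemma loc_const_char_coef k (f : K -> K) :
  (forall x y (n : nat), ordge 0 x -> ordge 0 y -> ordge n (x - y) ->
    ordge n (f x - f y)) -> loc_const (fun x => g k (f x)).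
Proof. by move=> h; exists (k + c)%N; apply: level_char_coef => x y; exact: h. Qed.

(** The elements of valuation k + 1 are [pi] times those of valuation k, with the same angular
    components. *)
Lemma mean_char_coefS k : mean (g k.+1) = q^-1 * mean (g k).
Proof.
have l j : loc_const (g j) by apply: (@loc_const_char_coef j id).
rewrite (mean_supp_pi hpi) //; last first.
  by move=> x hx h; apply: char_coef_ord; apply: contra h => /eqP e;
    rewrite /ordge e orbT.
congr (_ * _); apply: (eq_mean hpi) => // x hx.
by have := char_coef_piX k 1 x; rewrite addn1 expr1.
Qed.

(** If [r] divides [a], the substitution is an isometry followed by a power of [pi], and the claim
    is that for the identity, shifted by ord r. Otherwise a + r t has constant valuation ord a < ord
    r <= k, and both sides vanish. *)
Lemma mean_char_coef_affine k a r : ordge 0 a -> r != 0 -> 0 <= ord r -> ord r <= k%:Z ->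
  mean (fun t => g k.+1 (a + r * t)) = q^-1 * mean (fun t => g k (a + r * t)).
Proof.
move=> ha r0 or0 ork.
have [har|har] := boolP (ordge (ord r) a).
  have [n on] : exists n : nat, ord r = n by case: (ord r) or0 => // n; exists n.
  have hb : ordge 0 (a / r).
    by rewrite -(subrr (ord r)); apply: ordgeM; rewrite // ordgeE ?invr_eq0 // ordV.
  have hu := ac_unit r0.
  have lr : r = pi ^+ n * ac pi r.
    rewrite /ac on -exprnN mulrC divfK //; exact: piX_neq0.
  have key j : (n <= j)%N -> mean (fun t => g j (a + r * t)) = mean (g (j - n)).
    move=> nj.
    have l i : loc_const (g i) by apply: (@loc_const_char_coef i id).
    rewrite -(mean_isometric hpi (l (j - n)%N) (isometric_unit hu)).
    have l' := loc_const_isometric (l (j - n)%N) (isometric_unit hu).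
    rewrite -(mean_isometric hpi l' (isometric_add hb)); apply: (eq_mean hpi).
      exact: loc_const_isometric l' (isometric_add hb).
    move=> t ht; rewrite -(char_coef_piX (j - n) n) subnK // mulrA -lr.
    by congr (g j _); field.
  have nk : (n <= k)%N by move: ork; rewrite on; lia.
  by rewrite !key //; [rewrite subSn // mean_char_coefS | lia].
have a0 : a != 0 by apply: contraNneq har => ->; exact: ordge0.
have oa : ord a < ord r by move: har; rewrite ordgeE // -ltNge.
have z j : (k <= j)%N -> mean (fun t => g j (a + r * t)) = 0.
  move=> kj; rewrite -[RHS](mean_cst hpi 0); apply: (eq_mean hpi).
    exact: loc_const_cst.
  move=> t ht; have hrt : ordge (ord r) (r * t).
    by apply: ordgeMr; rewrite // ordgeE.
  have [_ e] := ord_addl a0 oa hrt; apply: char_coef_ord; rewrite e.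
  by apply/eqP; lia.
by rewrite !z ?mulr0.
Qed.

Lemma ordge_subX n x y k : ordge 0 x -> ordge 0 y -> ordge n (x - y) ->
  ordge n (x ^+ k - y ^+ k).
Proof.
move=> hx hy h; rewrite subrXX; apply: ordgeMr => //; apply: ordge_sum => i _.
by apply: ordgeMl; exact: ordgeX.
Qed.

Variable m : nat.
Hypothesis m_unit : OKunit (m%:R : K).

(** The difference of two m-th powers is the difference of the bases times a sum of m products of
    elements of 1 + P_K. That sum is congruent to the unit m modulo P_K, so two values of the map
    differ by a unit times x - y. *)
Lemma isometric_pow w : w != 0 -> ordge 1 w ->
  isometric (fun t => ((1 + w * t) ^+ m - 1) / (m%:R * w)).
Proof.
move=> w0 hw; pose phi t := ((1 + w * t) ^+ m - 1) / (m%:R * w).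
have e x y : ordge 0 x -> ordge 0 y ->
    exists2 u, OKunit u & phi x - phi y = u * (x - y).
  move=> hx hy.
  have hX z i : ordge 0 z -> ordge 1 ((1 + w * z) ^+ i - 1).
    move=> hz; rewrite -[X in _ - X](expr1n _ i); apply: ordge_subX.
    - by apply: ordgeD; [exact: ordge01 | rewrite ordgeMr // (ordgeW _ hw)].
    - exact: ordge01.
    - by rewrite addrAC subrr add0r ordgeMr.
  set s := \sum_(i < m) (1 + w * x) ^+ (m.-1 - i) * (1 + w * y) ^+ i.
  have hs : ordge 1 (s - m%:R).
    have -> : s - m%:R = \sum_(i < m) ((1 + w * x) ^+ (m.-1 - i) * (1 + w * y) ^+ i - 1).
      by rewrite sumrB sumr_const card_ord.
    apply: ordge_sum => i _; rewrite -(subrKA ((1 + w * y) ^+ i)).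
    apply: ordgeD; last exact: hX.
    rewrite -[X in _ - X]mul1r -mulrBl; apply: ordgeMr; first exact: hX.
    by apply/ordgeX/ordgeD; [exact: ordge01 | rewrite ordgeMr // (ordgeW _ hw)].
  exists (s / m%:R).
    by apply: OKunitM; [exact: OKunit_near hs | exact: OKunitV].
  rewrite /phi -mulrBl opprB addrA subrK subrXX.
  rewrite (_ : \sum_(i < m) _ = s); last first.
    by apply: eq_bigr => i _; congr (_ ^+ _ * _); lia.
  have m0 := m_unit.1; field; exact/andP.
split=> [x hx|x y j hx hy].
  have [u hu] := e x 0 hx (ordge0 K 0).
  rewrite /phi mulr0 addr0 expr1n subrr mul0r !subr0 => ->.
  by rewrite ordge_unitM.
by have [u hu] := e x y hx hy; rewrite /phi => ->; rewrite ordge_unitM.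
Qed.

Variable mu : K.
Hypotheses (mu_neq0 : mu != 0) (mu_int : ordge 0 mu).

Lemma ordge_xi_pow n (xi y y' : K) : ordge 0 y -> ordge 0 y' -> ordge n (y - y') ->
  ordge n (xi + mu * y ^+ m - (xi + mu * y' ^+ m)).
Proof.
move=> hy hy' h; rewrite opprD addrACA subrr add0r -mulrBr.
by apply: ordgeMl => //; exact: ordge_subX.
Qed.

Lemma eq_ordge n x y : ordge n (x - y) -> ordge n x = ordge n y.
Proof. by move=> h; rewrite -{1}[x](subrK y) addrC ordgeDl. Qed.

(* On the coset of y0 with y = y0(1 + w t), the value is affine in
   phi(t) = ((1 + w t)^m - 1)/(m w), and phi is an isometry. *)
Lemma mean_char_coef_smooth (Y : nat) : exists B : nat, forall xi k, ordge 0 xi ->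
  (B <= k)%N ->
  mean (fun y => if ordge Y y then 0 else g k.+1 (xi + mu * y ^+ m)) =
  q^-1 * mean (fun y => if ordge Y y then 0 else g k (xi + mu * y ^+ m)).
Proof.
(* The slope [r] below has valuation ord mu + m ord y0 + Y - ord y0 with 0 <= ord y0 < Y, which this
   bound dominates. It does not depend on [xi], so the relation survives a later mean over x. *)
exists (`|ord mu| + m * Y + Y)%N => xi k hxi hk.
have l j : loc_const (fun y => if ordge Y y then 0 else g j (xi + mu * y ^+ m)).
  exists (Y + (j + c))%N => y y' hy hy' h; rewrite (@eq_ordge Y _ y'); last first.
    by apply: ordgeW h; lia.
  case: ifP => // _; apply: char_coef_cong; apply: ordge_xi_pow => //.
  by apply: ordgeW h; lia.
rewrite !(mean_split hpi Y (l _)) mulrCA; congr (_ * _); rewrite mulr_sumr.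
rewrite big_seq_cond [RHS]big_seq_cond; apply: eq_bigr => y0.
rewrite andbT => /(representatives_ordge0 hpi) hy0.
have ind y : ordge 0 y -> ordge Y (y0 + pi ^+ Y * y) = ordge Y y0.
  by move=> hy; rewrite ordgeDl // ordgeMr // ordge_piX.
have [hY|hY] := boolP (ordge Y y0).
  have z j : mean (fun y => if ordge Y (y0 + pi ^+ Y * y) then 0 else
      g j (xi + mu * (y0 + pi ^+ Y * y) ^+ m)) = 0.
    rewrite -[RHS](mean_cst hpi 0); apply: (eq_mean hpi); first exact: loc_const_cst.
    by move=> y hy; rewrite ind // hY.
  by rewrite !z mulr0.
have y00 : y0 != 0 by apply: contraNneq hY => ->; exact: ordge0.
have oy0 : 0 <= ord y0 by rewrite -ordgeE.
have oyY : ord y0 < Y by move: hY; rewrite ordgeE // -ltNge.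
(* The coset y0 + P_K^Y is y0(1 + w O_K), with [w] in P_K because ord y0 < Y. *)
set w := pi ^+ Y / y0.
have w0 : w != 0 by rewrite mulf_neq0 ?piX_neq0 // invr_eq0.
have ow : ord w = Y%:Z - ord y0 by rewrite ord_mul ?piX_neq0 ?invr_eq0 // ord_piX // ordV.
have hw : ordge 1 w by rewrite ordgeE // ow; lia.
have iso := isometric_pow w0 hw.
set phi := (fun t => _) in iso.
set r := mu * y0 ^+ m * (m%:R * w).
have m0 := m_unit.1.
have r0 : r != 0 by apply: mulf_neq0; apply: mulf_neq0 => //; exact: expf_neq0.
have or : ord r = ord mu + ord y0 * m%:Z + (Y%:Z - ord y0).
  have y0m : y0 ^+ m != 0 by exact: expf_neq0.
  rewrite /r ord_mul; [|exact: mulf_neq0|exact: mulf_neq0].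
  rewrite (ord_mul mu_neq0 y0m) (ord_mul m0 w0) ordX //.
  by rewrite m_unit.2 ow add0r.
have omu : 0 <= ord mu by rewrite -ordgeE.
have le1 : 0 <= ord y0 * m%:Z by apply: mulr_ge0.
have le2 : ord y0 * m%:Z <= (m * Y)%N.
  by rewrite mulnC PoszM; apply: ler_wpM2r => //; exact: ltW.
have or_ge0 : 0 <= ord r by rewrite or; clear -omu le1 oyY; lia.
have or_le : ord r <= k%:Z by rewrite or; clear -hk omu le2 oy0; lia.
have a0 : ordge 0 (xi + mu * y0 ^+ m) by apply: ordgeD => //; rewrite ordgeMl ?ordgeX.
have e j : mean (fun y => if ordge Y (y0 + pi ^+ Y * y) then 0 else
      g j (xi + mu * (y0 + pi ^+ Y * y) ^+ m)) =
    mean (fun t => g j (xi + mu * y0 ^+ m + r * t)).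
  have lj : loc_const (fun t => g j (xi + mu * y0 ^+ m + r * t)).
    apply: loc_const_char_coef => x y n hx hy h.
    rewrite opprD addrACA subrr add0r -mulrBr; apply: ordgeMl => //.
    by rewrite ordgeE.
  rewrite -(mean_isometric hpi lj iso); apply: (eq_mean hpi).
    exact: loc_const_isometric lj iso.
  move=> y hy; rewrite ind // (negPf hY); congr (g j _).
  have -> : y0 + pi ^+ Y * y = y0 * (1 + w * y) by rewrite /w; field.
  by rewrite /r /phi exprMn; field; apply/andP.
by rewrite !e mean_char_coef_affine.
Qed.

Variable p : nat.
Hypotheses (hp : p \in [pchar K]) (hpm : ~~ (p %| m)%N).

(* u^(p^n) = 1 + (u - 1)^(p^n) is close to 1, so if b m = -1 mod p^n then u^b is
   an approximate m-th root of u^-1. *)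
Lemma one_unit_inv_root u (n : nat) : ordge 1 (u - 1) ->
  exists2 v, OKunit v & ordge n (u * v ^+ m - 1).
Proof.
move=> hu; have pp := pcharf_prime hp.
have uu : OKunit u by apply: OKunit_near (OKunit1 K) hu.
have hz (i : nat) : ordge i ((u - 1) ^+ i).
  elim: i => [|i IH]; first by rewrite expr0; exact: ordge01.
  have -> : i.+1%:Z = 1 + i%:Z by lia.
  by rewrite exprS; exact: ordgeM.
have hpn : ordge n (u ^+ (p ^ n) - 1).
  have -> : u ^+ (p ^ n) - 1 = (u - 1) ^+ (p ^ n).
    elim: (n) => [|i IH]; first by rewrite expn0 !expr1.
    by rewrite expnSr !exprM -IH -!(pFrobenius_autE hp) rmorphB rmorph1.
  by apply: ordgeW (hz _); rewrite lez_nat ltnW // ltn_expl // prime_gt1.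
have cop : coprime (p ^ n) m by rewrite coprimeXl // prime_coprime.
have pn_gt0 : (0 < p ^ n)%N by rewrite expn_gt0 prime_gt0.
have [b _] := Bezoutl m pn_gt0.
rewrite (eqP cop) addnC => /dvdnP[a ea].
exists (u ^+ b); first exact: OKunitX.
rewrite -exprM -exprS -addn1 [(b * m + 1)%N]ea mulnC exprM -[X in _ - X](expr1n _ a).
by apply: ordge_subX => //; [apply/OKunit_ordge/OKunitX | exact: ordge01].
Qed.

(** Take v with u v^m close to 1 and replace y by v y. Multiplying the value by [u], on which [chi]
    is 1, gives u xi + mu y^m up to the precision k + c that [char_coef] detects. *)
Lemma mean_char_coef_one_unit k xi u : OKunit u -> ordge c (u - 1) ->
  mean (fun y => g k (u * xi + mu * y ^+ m)) = mean (fun y => g k (xi + mu * y ^+ m)).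
Proof.
move=> hu hc; have [|v hv hv1] := @one_unit_inv_root u (k + c).
  by apply: ordgeW hc; lia.
have l a : loc_const (fun y => g k (a + mu * y ^+ m)).
  by apply: loc_const_char_coef => x y n; exact: ordge_xi_pow.
rewrite -[RHS](mean_isometric hpi (l _) (isometric_unit hv)).
apply/esym; apply: (eq_mean hpi) => // y hy.
rewrite -(@char_coef_one_unitM k u) //; apply: char_coef_cong.
rewrite mulrDr opprD addrACA subrr add0r mulrCA -mulrBr; apply: ordgeMl => //.
rewrite exprMn mulrA -[X in _ - X]mul1r -mulrBl; apply: ordgeMr => //.
exact: ordgeX.
Qed.

End AngularCoefficients.

(** * Recurrence for the coefficients of the zeta function *)

Section CoefficientSequences.
Variables (K : nonArchLocalFieldType) (pi : K) (hpi : uniformizer pi).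
Variables (C : numFieldType) (chi : K -> C) (c : nat).
Hypothesis c_gt0 : (0 < c)%N.
Hypothesis chiM : forall u v, OKunit u -> OKunit v -> chi (u * v) = chi u * chi v.
Hypothesis chi1 : forall u, OKunit u -> ordge c (u - 1) -> chi u = 1.
Variable m : nat.
Hypotheses (m_gt0 : (0 < m)%N) (m_unit : OKunit (m%:R : K)).
Variable mu : K.
Hypotheses (mu_neq0 : mu != 0) (mu_int : ordge 0 mu).
Implicit Types (x y xi : K) (u : K -> K) (s a : nat -> C).

Local Notation q := ((residue_card K)%:R : C).
Local Notation mean := (mean pi (C := C)).
Local Notation g := (char_coef pi chi).

(** A class of unit factors stable under x |-> pi^j x, as rescaling requires. The Lipschitz bound
    lets x^d u(x) respect congruences like a polynomial with integral coefficients. *)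
Definition unit_lipschitz u := (forall x, ordge 0 x -> OKunit (u x)) /\
  forall x y (n : nat), ordge 0 x -> ordge 0 y -> ordge n (x - y) ->
    ordge n (u x - u y).

Definition coef_seq d u (k : nat) : C :=
  mean (fun x => mean (fun y => g k (x ^+ d * u x + mu * y ^+ m))).

(** Equivalently, the generating series is a polynomial divided by 1 - q^-1 t. *)
Definition eventually_geometric a :=
  exists B : nat, forall k, (B <= k)%N -> a k.+1 = q^-1 * a k.

(** Multiplication of the generating series by t^L. *)
Definition shift_seq (L : nat) a k : C := if (L <= k)%N then a (k - L)%N else 0.

Lemma eventually_geometricD a b : eventually_geometric a -> eventually_geometric b ->
  eventually_geometric (fun k => a k + b k).
Proof.
move=> [A hA] [B hB]; exists (maxn A B) => k; rewrite geq_max => /andP[hk hk'].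
by rewrite hA // hB // mulrDr.
Qed.

Lemma eventually_geometricZ l a : eventually_geometric a ->
  eventually_geometric (fun k => l * a k).
Proof. by move=> [A hA]; exists A => k hk; rewrite hA // mulrCA. Qed.

Lemma eventually_geometric_shift L a : eventually_geometric a ->
  eventually_geometric (shift_seq L a).
Proof.
move=> [A hA]; exists (A + L)%N => k hk; rewrite /shift_seq.
have Lk : (L <= k)%N by lia.
by rewrite Lk leqW // subSn // hA //; lia.
Qed.

Lemma ordge_pow_unit d x v : ordge 0 x -> OKunit v -> ordge 0 (x ^+ d * v).
Proof. by move=> hx /OKunit_ordge hv; rewrite ordgeMl ?ordgeX. Qed.

Lemma level2_char_coef d u k : unit_lipschitz u ->
  level2 (k + c) (fun x y => g k (x ^+ d * u x + mu * y ^+ m)).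
Proof.
move=> [u0 ul] x x' y y' hx hx' hy hy' xx yy.
apply: (char_coef_cong hpi c_gt0 chiM chi1) => //.
rewrite opprD addrACA; apply: ordgeD; last first.
  by rewrite -mulrBr ordgeMl // ordge_subX.
rewrite -(subrKA (x' ^+ d * u x)) -mulrBl -mulrBr; apply: ordgeD.
  by rewrite ordgeMr ?ordge_subX //; apply/OKunit_ordge/u0.
by rewrite ordgeMl ?ordgeX // ul.
Qed.

Lemma loc_const_mean (n : nat) (F : K -> K -> C) : level2 n F ->
  loc_const (fun x => mean (F x)).
Proof. by move=> h; exists n; exact: level2_mean. Qed.

Lemma loc_const_char_coef_pow xi k : loc_const (fun y => g k (xi + mu * y ^+ m)).
Proof.
apply: (loc_const_char_coef hpi c_gt0 chiM chi1) => x y n; exact: ordge_xi_pow.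
Qed.

(** If ord y >= Y, then mu y^m has larger valuation than xi, so the value has valuation ord xi < Y
    and contributes nothing to indices k >= Y. The part with ord y < Y is the smooth case. *)
Lemma mean_char_coef_away (Y : nat) : exists B : nat, forall xi k, xi != 0 ->
  0 <= ord xi -> ord xi < Y%:Z -> (B <= k)%N ->
  mean (fun y => g k.+1 (xi + mu * y ^+ m)) =
  q^-1 * mean (fun y => g k (xi + mu * y ^+ m)).
Proof.
have [B hB] := mean_char_coef_smooth hpi c_gt0 chiM chi1 m_unit mu_neq0 mu_int Y.
exists (B + Y)%N => xi k xi0 oxi oxiY hk.
have e j : (Y <= j)%N -> mean (fun y => g j (xi + mu * y ^+ m)) =
    mean (fun y => if ordge Y y then 0 else g j (xi + mu * y ^+ m)).
  move=> hj; apply/esym; apply: (eq_mean hpi); first exact: loc_const_char_coef_pow.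
  move=> y hy; case: ifP => // hY.
  have hmu : ordge Y (mu * y ^+ m).
    by rewrite -(prednK m_gt0) exprS ordgeMl // ordgeMr // ordgeX.
  have [_ o] := ord_addl xi0 oxiY hmu.
  by rewrite char_coef_ord // o; apply/eqP; lia.
by rewrite !e ?hB ?ordgeE //; lia.
Qed.

Lemma coef_seq0 u : unit_lipschitz u -> eventually_geometric (coef_seq 0 u).
Proof.
(* Here [xi] is the unit u(x), of valuation 0, so Y = 1 suffices. *)
move=> hu; have [B hB] := mean_char_coef_away 1.
exists B => k hk; rewrite /coef_seq -(meanZ hpi); last first.
  exact: loc_const_mean (level2_char_coef 0 hu).
have [n hn] := loc_const_mean (level2_char_coef 0 (k := k) hu).
apply: (eq_mean hpi) => [|x hx].
  by exists n => x y hx hy h; rewrite (hn x y).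
rewrite !expr0 !mul1r; have [u0 ou] := hu.1 x hx.
by rewrite hB // ou.
Qed.

Lemma coef_seq1 u : unit_lipschitz u -> isometric (fun x => x * u x) ->
  eventually_geometric (coef_seq 1 u).
Proof.
move=> hu iso; exists 0%N => k _.
have l j : loc_const (g j).
  by apply: (@loc_const_char_coef _ _ hpi _ _ _ c_gt0 chiM chi1 j id).
have e j : coef_seq 1 u j = mean (g j).
  (* Once the mean over x is taken first, mu y^m is a mere translation, absorbed like x |-> x
     u(x). *)
  rewrite /coef_seq (mean_swap hpi (level2_char_coef 1 hu)).
  rewrite -[RHS](mean_cst hpi); apply: (eq_mean hpi) => [|y hy].
    exact: loc_const_cst.
  have hb : ordge 0 (mu * y ^+ m) by rewrite ordgeMl ?ordgeX.
  have l' := loc_const_isometric (l j) (isometric_add hb).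
  rewrite -[RHS](mean_isometric hpi (l j) (isometric_add hb)).
  rewrite -(mean_isometric hpi l' iso).
  apply: (eq_mean hpi) => [|x hx]; first exact: loc_const_isometric l' iso.
  by rewrite expr1.
by rewrite !e (mean_char_coefS hpi c_gt0 chiM chi1).
Qed.

(** In the application m' = m~, d' = d~ and L = lcm(d, m): [m'] and [d'] are the weights of x and y
    for which x^d and y^m scale by the same power [pi ^+ L]. *)
Variables (d m' d' L : nat).
Hypotheses (Ld : (m' * d = L)%N) (Lm : (d' * m = L)%N) (m'_gt0 : (0 < m')%N).

Local Notation lambda := (q^-1 ^+ (m' + d')).

Lemma unit_lipschitz_scale j u : unit_lipschitz u ->
  unit_lipschitz (fun x => u (pi ^+ j * x)).
Proof.
move=> [u0 ul]; have hj : ordge 0 (pi ^+ j) by apply: ordgeW (ordge_piX hpi j).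
split=> [x hx|x y n hx hy h]; first by apply: u0; rewrite ordgeMl.
by apply: ul; rewrite ?ordgeMl // -mulrBr ordgeMl.
Qed.

(* The part of the integral over [ord x >= m', ord y >= d'] is a rescaled copy of
   the whole integral; on the rest the curve is smooth. *)
Lemma coef_seq_rec u : unit_lipschitz u -> exists2 a, eventually_geometric a &
  forall k, coef_seq d u k = a k +
    lambda * shift_seq L (coef_seq d (fun x => u (pi ^+ m' * x))) k.
Proof.
move=> hu; pose h x y := x ^+ d * u x + mu * y ^+ m.
pose F k x y : C := if ordge m' x && ordge d' y then 0 else g k (h x y).
pose G k x y : C := if ordge m' x && ordge d' y then g k (h x y) else 0.
(* The extra m' + d' in the level makes the two cutoffs locally constant at that level too. *)
have ind (k : nat) x x' y y' : ordge (k + c + m' + d')%N (x - x') ->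
    ordge (k + c + m' + d')%N (y - y') ->
    ordge m' x && ordge d' y = ordge m' x' && ordge d' y'.
  move=> xx yy; rewrite (@eq_ordge _ m' x x') ?(@eq_ordge _ d' y y') //.
    by apply: ordgeW yy; lia.
  by apply: ordgeW xx; lia.
have hg k : level2 (k + c + m' + d') (fun x y => g k (h x y)).
  move=> x x' y y' hx hx' hy hy' xx yy; apply: (level2_char_coef d hu) => //.
    by apply: ordgeW xx; lia.
  by apply: ordgeW yy; lia.
have hF k : level2 (k + c + m' + d') (F k).
  move=> x x' y y' hx hx' hy hy' xx yy; rewrite /F (ind k x x' y y') //.
  by case: ifP => // _; exact: hg.
have hG k : level2 (k + c + m' + d') (G k).
  move=> x x' y y' hx hx' hy hy' xx yy; rewrite /G (ind k x x' y y') //.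
  by case: ifP => // _; exact: hg.
exists (fun k => mean (fun x => mean (F k x))).
  (* Where ord x >= m', only ord y < d' is left: the smooth case with Y = d'. Elsewhere ord (x^d
     u(x)) = d ord x <= m' d; the successor keeps the bound strict even for d = 0. *)
  have [B1 hB1] := mean_char_coef_smooth hpi c_gt0 chiM chi1 m_unit mu_neq0 mu_int d'.
  have [B2 hB2] := mean_char_coef_away (m' * d).+1.
  exists (B1 + B2)%N => k hk; rewrite -(meanZ hpi); last exact: loc_const_mean (hF k).
  apply: (eq_mean hpi) => [|x hx].
    by have [n hn] := loc_const_mean (hF k); exists n => x y hx hy e; rewrite (hn x y).
  rewrite /F; have [hm|hm] /= := boolP (ordge m' x).
    by rewrite hB1 //; [apply: ordge_pow_unit => //; exact: hu.1 | lia].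
  have x0 : x != 0 by apply: contraNneq hm => ->; exact: ordge0.
  have [u0 ou] := hu.1 x hx.
  have ox : 0 <= ord x by rewrite -ordgeE.
  have oxm : ord x < m' by move: hm; rewrite ordgeE // -ltNge.
  have oxi : ord (x ^+ d * u x) = ord x * d%:Z.
    by rewrite ord_mul ?expf_neq0 // ou addr0 ordX.
  apply: hB2; rewrite ?oxi ?mulf_neq0 ?expf_neq0 //.
  - exact: mulr_ge0.
  - have : ord x * d%:Z <= m'%:Z * d%:Z by apply: ler_wpM2r => //; exact: ltW.
    lia.
  - lia.
move=> k; have -> : coef_seq d u k =
    mean (fun x => mean (F k x)) + mean (fun x => mean (G k x)).
  rewrite -(meanD hpi); [|exact: loc_const_mean (hF k)|exact: loc_const_mean (hG k)].
  apply: (eq_mean hpi) => [|x hx].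
    have [n [lF lG]] := loc_const2 (loc_const_mean (hF k)) (loc_const_mean (hG k)).
    by exists n => x y hx hy e; rewrite (lF x y) // (lG x y).
  have lF := level2l (hF k) hx; have lG := level2l (hG k) hx.
  rewrite -(meanD hpi); [|by eexists; exact: lF|by eexists; exact: lG].
  apply: (eq_mean hpi) => [|y hy].
    by exists (k + c + m' + d')%N => y y' hy hy' e; rewrite (lF y y') // (lG y y').
  by rewrite /F /G /h; case: ifP => _; rewrite ?add0r ?addr0.
congr (_ + _).
have hm' : ordge 0 (pi ^+ m') by apply: ordgeW (ordge_piX hpi m').
have hd' : ordge 0 (pi ^+ d') by apply: ordgeW (ordge_piX hpi d').
rewrite (mean_supp_piX hpi (n := m')) //; first last.
- move=> x hx hm; rewrite -[RHS](mean_cst hpi 0); apply: (eq_mean hpi) => [|y hy].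
    exact: loc_const_cst.
  by rewrite /G (negPf hm).
- exact: loc_const_mean (hG k).
have hu1 := unit_lipschitz_scale m' hu.
have e x : ordge 0 x -> mean (G k (pi ^+ m' * x)) = q^-1 ^+ d' *
    mean (fun y => G k (pi ^+ m' * x) (pi ^+ d' * y)).
  move=> hx; rewrite (mean_supp_piX hpi (n := d')) //; first last.
    by move=> y hy hd; rewrite /G (negPf hd) andbF.
  by eexists; apply: level2l (hG k) _; rewrite ordgeMl.
have e2 x y : ordge 0 x -> ordge 0 y -> G k (pi ^+ m' * x) (pi ^+ d' * y) =
    if (L <= k)%N then g (k - L) (x ^+ d * u (pi ^+ m' * x) + mu * y ^+ m) else 0.
  move=> hx hy; rewrite /G !ordge_piM // !subrr hx hy /=.
  have -> : h (pi ^+ m' * x) (pi ^+ d' * y) =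
      pi ^+ L * (x ^+ d * u (pi ^+ m' * x) + mu * y ^+ m).
    by rewrite /h !exprMn -!exprM Ld Lm; ring.
  have hh : ordge 0 (x ^+ d * u (pi ^+ m' * x) + mu * y ^+ m).
    apply: ordgeD; last by rewrite ordgeMl ?ordgeX.
    by apply: ordge_pow_unit => //; exact: hu1.1.
  (* The value is divisible by [pi ^+ L], so the coefficients of index below L vanish: this is the
     zero branch of [shift_seq]. *)
  case: leqP => Lk; first by rewrite -{1}(subnK Lk) char_coef_piX.
  by apply: char_coef_ordge; rewrite ordge_piM //; apply: ordgeW hh; lia.
(* Contracting x by [pi ^+ m'] costs q^-m' and y by [pi ^+ d'] costs q^-d', whence [lambda]. *)
rewrite exprD -mulrA; congr (_ * _).
rewrite /shift_seq; case: leqP => Lk in e2 *; last first.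
  rewrite mulr0 -[RHS](mean_cst hpi 0); apply: (eq_mean hpi) => [|x hx].
    exact: loc_const_cst.
  rewrite e // -[RHS](mulr0 (q^-1 ^+ d')); congr (_ * _); rewrite -[RHS](mean_cst hpi 0).
  by apply: (eq_mean hpi) => [|y hy]; [exact: loc_const_cst | rewrite e2].
have lu := level2_char_coef d (k := (k - L)%N) hu1.
rewrite -(meanZ hpi); last exact: loc_const_mean lu.
apply: (eq_mean hpi) => [|x hx].
  by have [n hn] := loc_const_mean lu; exists n => x y hx hy f; rewrite (hn x y).
rewrite e //; congr (_ * _); apply: (eq_mean hpi) => [|y hy]; last by rewrite e2.
by eexists; exact: level2l lu hx.
Qed.

Variable p : nat.
Hypotheses (hp : p \in [pchar K]) (hpm : ~~ (p %| m)%N).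

Lemma coef_seq_one_unit u (mu1 : K) k : OKunit mu1 -> unit_lipschitz u ->
  (forall x, ordge 0 x -> ordge c (u x - mu1)) ->
  coef_seq d u k = coef_seq d (fun=> mu1) k.
Proof.
move=> hmu hu huc; have [mu10 omu1] := hmu.
have hcst : unit_lipschitz (fun=> mu1).
  by split=> // x y n _ _ _; rewrite subrr ordge0.
apply: (eq_mean hpi) => [|x hx]; first exact: loc_const_mean (level2_char_coef d hcst).
have -> : x ^+ d * u x = u x / mu1 * (x ^+ d * mu1) by field.
apply: (mean_char_coef_one_unit hpi c_gt0 chiM chi1 mu_neq0 mu_int hp hpm).
  by apply: OKunitM; [exact: hu.1 | exact: OKunitV].
rewrite -(divff mu10) -mulrBl; apply: ordgeMr; first exact: huc.
by apply/OKunit_ordge/OKunitV.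
Qed.

(** Induction on the number j of scalings by [pi] after which [u] agrees with [mu1] modulo P_K^c.
    For j = 0, rescaling leaves the sequence unchanged, so the recurrence relates it to itself. *)
Lemma coef_seq_rational u (mu1 : K) j : OKunit mu1 -> unit_lipschitz u ->
  (forall x, ordge 0 x -> ordge c (u (pi ^+ j * x) - mu1)) ->
  eventually_geometric (fun k =>
    coef_seq d u k - lambda * shift_seq L (coef_seq d u) k).
Proof.
move=> hmu; elim: j u => [|j IH] u hu huc.
  have [a ha e] := coef_seq_rec hu.
  case: ha => B hB; exists B => k hk.
  have huc0 x : ordge 0 x -> ordge c (u x - mu1).
    by move=> hx; have := huc x hx; rewrite expr0 mul1r.
  have hm' : ordge 0 (pi ^+ m') by apply: ordgeW (ordge_piX hpi m').
  have e0 i : coef_seq d (fun x => u (pi ^+ m' * x)) i = coef_seq d u i.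
    rewrite (coef_seq_one_unit _ hmu hu) // (coef_seq_one_unit _ hmu) //.
      exact: unit_lipschitz_scale.
    by move=> x hx; apply: huc0; rewrite ordgeMl.
  have e1 i : coef_seq d u i - lambda * shift_seq L (coef_seq d u) i = a i.
    by rewrite e /shift_seq; case: ifP => _; rewrite ?e0 addrK.
  by rewrite !e1 hB.
have hu1 := unit_lipschitz_scale m' hu.
have [a ha e] := coef_seq_rec hu.
have [|B hB] := IH _ hu1.
  (* As m' > 0, one rescaling gains at least one factor [pi]: pi^m' pi^j x = pi^(j+1) (pi^(m'-1)
     x). *)
  move=> x hx; rewrite mulrA -exprD -(prednK m'_gt0) addSnnS exprD.
  rewrite -mulrA [_ * (_ * x)]mulrCA.
  by apply: huc; rewrite ordgeMl //; apply: ordgeW (ordge_piX hpi _).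
set u1 := (fun x => u (pi ^+ m' * x)) in e hB *.
have := eventually_geometricD ha (eventually_geometricD
  (eventually_geometricZ (- lambda) (eventually_geometric_shift L ha))
  (eventually_geometricZ lambda (eventually_geometric_shift L (ex_intro _ B hB)))).
case=> N hN; exists N => k hk.
have E i : coef_seq d u i - lambda * shift_seq L (coef_seq d u) i =
   a i + (- lambda * shift_seq L a i + lambda * shift_seq L (fun k =>
    coef_seq d u1 k - lambda * shift_seq L (coef_seq d u1) k) i).
  by rewrite e /shift_seq; case: ifP => _; rewrite ?e /shift_seq; ring.
by rewrite !E hN.
Qed.

End CoefficientSequences.

(** * The Haar integral *)

Section Haar.
Variables (R : realType) (K : nonArchLocalFieldType) (pi : K) (hpi : uniformizer pi).
Variable mu : {measure set (borelKn K 2) -> \bar R}.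
Hypothesis hmu : normalized_haar mu.

Definition box (n : nat) (x y : K) : set (borelKn K 2) :=
  [set z : 'rV[K]_2 | ordge n (z ord0 ord0 - x) && ordge n (z ord0 ord_max - y)].

Lemma nbhs_ordge (n : int) (x : K) : nbhs x [set y | ordge n (y - x)].
Proof.
have : @entourage K [set xy | ordge n (xy.1 - xy.2)].
  rewrite entourage_ord; exists n => // -[a b] /= [/eqP h|h]; apply/orP; by [left|right].
move=> /nbhs_entourage - /(_ x); apply: filterS => y.
by rewrite /xsection /= inE /= ordgeC.
Qed.

Lemma OKnE : @OKn K 2 = box 0 0 0.
Proof.
apply/seteqP; split=> [z h|z /andP[]].
  by apply/andP; split; rewrite subr0; apply/OK_ordge; exact: h.
rewrite !subr0 => h0 h1 i; apply/OK_ordge.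
have [->//|-> //] : i = ord0 \/ i = ord_max.
by case: i => -[|[|//]] hi; [left|right]; exact: val_inj.
Qed.

Lemma measurable_box n x y : measurable (box n x y).
Proof.
apply: sub_sigma_algebra; rewrite openE => z /andP[h0 h1].
exists (fun i j => [set y | ordge n (y - z i j)]) => [i j|z' h].
  exact: nbhs_ordge.
apply/andP; split.
  by rewrite -(subrKA (z ord0 ord0)); apply: ordgeD => //; exact: h.
by rewrite -(subrKA (z ord0 ord_max)); apply: ordgeD => //; exact: h.
Qed.

Lemma measurable_OKn : measurable (@OKn K 2).
Proof. by rewrite OKnE; exact: measurable_box. Qed.

Lemma haar_box n x y : mu (box n x y) = mu (box n 0 0).
Proof.
pose a : 'rV[K]_2 := \row_i (if i == ord0 then x else y).
rewrite -(hmu.1 a _ (measurable_box n 0 0)); congr (mu _).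
apply/seteqP; split=> [z /andP[h0 h1]|_ [z /andP[h0 h1] <-]].
  exists (z - a : 'rV[K]_2); last by rewrite addrC subrK.
  by apply/andP; rewrite !mxE /= !subr0.
by apply/andP; rewrite !mxE /= !(addrC _ (z _ _)) !addrK; move: h0 h1; rewrite !subr0.
Qed.

Lemma box_subset_OKn n x y : ordge 0 x -> ordge 0 y -> box n x y `<=` @OKn K 2.
Proof.
move=> hx hy z /andP[h0 h1]; rewrite OKnE; apply/andP; split; rewrite subr0.
  by rewrite -[z _ _](subrK x); apply: ordgeD => //; apply: ordgeW h0.
by rewrite -[z _ _](subrK y); apply: ordgeD => //; apply: ordgeW h1.
Qed.

Local Notation reps := (representatives pi).

(** Exactly one representative is congruent to [w], and [f] takes the value f w there. *)
Lemma sum_representatives (n : nat) (f : K -> R) w : ordge 0 w ->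
  (forall x, ordge 0 x -> ordge n (w - x) -> f x = f w) ->
  \sum_(x <- reps n) f x * (ordge n (w - x))%:R = f w.
Proof.
move=> hw hf; have [x hx h] := representativesP hpi n hw.
rewrite (bigD1_seq x) //=; last exact: uniq_representatives.
rewrite h mulr1 hf //; last exact: representatives_ordge0 hx.
rewrite big1_seq ?addr0 // => x' /andP[xx' hx']; case: (boolP (ordge n (w - x'))).
  move=> h'; move: xx'; rewrite (representatives_inj hpi hx' hx) ?eqxx //.
  by rewrite -(subrKA w); apply: ordgeD => //; rewrite ordgeC.
by rewrite mulr0.
Qed.

Lemma integrable_bounded (f : borelKn K 2 -> R) (M : R) :
  measurable_fun (@OKn K 2) f -> (forall z, @OKn K 2 z -> `|f z| <= M) ->
  mu.-integrable (@OKn K 2) (EFin \o f).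
Proof.
move=> mf hf; apply: measurable_bounded_integrable => //.
- exact: measurable_OKn.
- by rewrite hmu.2 ltry.
- exists M; split; first exact: num_real.
  by move=> y My z hz; apply: le_trans (hf z hz) (ltW My).
Qed.

Section Level2.
Variables (n : nat) (G : K -> K -> R).
Hypothesis hG : level2 n G.

(** A function of finite level is a step function on balls; its measurability and its integral are
    both read off this formula. *)
Lemma level2_indic (z : borelKn K 2) : @OKn K 2 z ->
  G ((z : 'rV[K]_2) ord0 ord0) ((z : 'rV[K]_2) ord0 ord_max) =
  \sum_(p <- [seq (x, y) | x <- reps n, y <- reps n]) G p.1 p.2 * \1_(box n p.1 p.2) z.
Proof.
move=> hz; rewrite big_allpairs_dep /=; set a := (z : 'rV[K]_2) _ ord0.
set b := (z : 'rV[K]_2) _ ord_max.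
have ha : ordge 0 a by apply/OK_ordge; exact: hz.
have hb : ordge 0 b by apply/OK_ordge; exact: hz.
rewrite -[LHS](@sum_representatives n (fun x => G x b) a ha); last first.
  by move=> x hx h; apply: hG; rewrite ?subrr ?ordge0 // ordgeC.
rewrite big_seq [RHS]big_seq; apply: eq_bigr => x /(representatives_ordge0 hpi) hx.
rewrite -[G x b](@sum_representatives n (fun y => G x y) b hb); last first.
  by move=> y hy h; apply: hG; rewrite ?subrr ?ordge0 // ordgeC.
rewrite mulr_suml; apply: eq_bigr => y _.
rewrite -mulrA -natrM mulnb andbC; congr (_ * _).
by rewrite indicE; congr (_%:R); congr nat_of_bool; apply/idP/idP; rewrite inE.
Qed.

Lemma measurable_level2 : measurable_fun (@OKn K 2)
  (fun z : borelKn K 2 => G ((z : 'rV[K]_2) ord0 ord0) ((z : 'rV[K]_2) ord0 ord_max)).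
Proof.
apply: (eq_measurable_fun (fun z => \sum_(p <- [seq (x, y) | x <- reps n, y <- reps n])
    G p.1 p.2 * \1_(box n p.1 p.2) z)).
  by move=> z; rewrite inE => hz; rewrite level2_indic.
apply: measurable_sum => p; apply: measurable_funM; first exact: measurable_cst.
by apply: measurable_indic; exact: measurable_box.
Qed.

Lemma Rintegral_level2_box : Rintegral mu (@OKn K 2)
    (fun z => G ((z : 'rV[K]_2) ord0 ord0) ((z : 'rV[K]_2) ord0 ord_max)) =
  fine (mu (box n 0 0)) * \sum_(x <- reps n) \sum_(y <- reps n) G x y.
Proof.
have mD := measurable_OKn.
have hb : mu (box n 0 0) \is a fin_num.
  rewrite ge0_fin_numE //; apply: (@le_lt_trans _ _ (mu (@OKn K 2))).
    apply: le_measure; rewrite ?inE //; [exact: measurable_box | ].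
    by apply: box_subset_OKn; exact: ordge0.
  by rewrite hmu.2 ltry.
have int p : mu.-integrable (@OKn K 2) (fun z => ((\1_(box n p.1 p.2) z : R)%:E)).
  apply: (@integrable_bounded _ 1).
    by apply: measurable_indic; exact: measurable_box.
  by move=> z _; rewrite indicE; case: (_ \in _); rewrite ?normr0 ?normr1 ?ler01.
rewrite /Rintegral.
under eq_integral => z.
  rewrite inE => /level2_indic ->.
  rewrite -sumEFin.
  under eq_bigr do rewrite EFinM.
  over.
rewrite integral_sum //; last by move=> p; apply: integrableZl => //; exact: int.
rewrite mulr_sumr; transitivity (fine (\sum_(p <- [seq (x, y) | x <- reps n, y <- reps n])
    (fine (mu (box n 0 0)) * G p.1 p.2)%:E)%E); last first.
  rewrite sumEFin big_allpairs_dep /=; apply: eq_bigr => x _.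
  by rewrite mulr_sumr.
congr fine; rewrite big_seq [RHS]big_seq; apply: eq_bigr => p.
have rep0 := @representatives_ordge0 _ _ hpi n.
move=> /allpairsP[[x y] /= [/rep0 hx /rep0 hy ->]] /=.
rewrite integralZl //; last exact: (int (x, y)).
rewrite integral_indic //; last exact: measurable_box.
rewrite setIidl; last exact: box_subset_OKn.
by rewrite haar_box mulrC EFinM fineK.
Qed.
End Level2.

(** The integral of the constant 1, computed on the q^(2n) balls of O_K^2, must be the total mass
    1. *)
Lemma fine_haar_box n : fine (mu (box n 0 0)) =
  (residue_card K)%:R^-1 ^+ n * (residue_card K)%:R^-1 ^+ n.
Proof.
have l1 : level2 n (fun _ _ : K => 1 : R) by [].
have := Rintegral_level2_box l1.
rewrite Rintegral_cst; last exact: measurable_OKn.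
rewrite hmu.2 mul1r /= big_const_seq count_predT iter_addr addr0.
rewrite big_const_seq count_predT iter_addr addr0 size_representatives.
rewrite -mulrnA natrM natrX => e.
have q0 := q_neq0 K R.
apply: (@mulIf _ ((residue_card K)%:R ^+ n * (residue_card K)%:R ^+ n)).
  by rewrite mulf_neq0 // expf_neq0.
by rewrite -e mulrACA -!exprMn mulVf // mulr1 expr1n.
Qed.

End Haar.

(** * Characters and complex powers *)

Section Modulus.
Variable R : realType.
Implicit Types (z w s : R[i]) (a b : R).

Local Notation normc := Normc.normc.

Lemma normc_ge0 z : 0 <= normc z.
Proof. by case: z => a b; exact: sqrtr_ge0. Qed.

Lemma normcX z n : normc (z ^+ n) = normc z ^+ n.
Proof.
by elim: n => [|n IH]; rewrite ?expr0 ?Normc.normc1 // !exprS Normc.normcM IH.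
Qed.

Lemma normc_real a : normc (a%:C)%C = `|a|.
Proof. by rewrite /= expr0n addr0 sqrtr_sqr. Qed.

Lemma normc_natr n : normc (n%:R : R[i]) = n%:R.
Proof. by rewrite -(rmorph_nat (real_complex R)) normc_real ger0_norm. Qed.

Lemma normr_Re_le z : `|complex.Re z| <= normc z.
Proof.
case: z => a b /=; rewrite -(@sqrtr_sqr R a) ler_wsqrtr //.
by rewrite lerDl sqr_ge0.
Qed.

Lemma normr_Im_le z : `|complex.Im z| <= normc z.
Proof.
case: z => a b /=; rewrite -(@sqrtr_sqr R b) ler_wsqrtr //.
by rewrite lerDr sqr_ge0.
Qed.

Lemma normc_le_ReIm z : normc z <= `|complex.Re z| + `|complex.Im z|.
Proof.
have -> : z = (complex.Re z +i* 0)%C + (0 +i* complex.Im z)%C.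
  by case: z => a b; rewrite /GRing.add /= addr0 add0r.
apply: le_trans (le_normcD _ _) _.
by rewrite /= expr0n addr0 add0r !sqrtr_sqr /= addr0 add0r.
Qed.

Lemma geometric_le0 a b r : 0 <= r -> r < 1 -> (forall n, a <= b * r ^+ n) -> a <= 0.
Proof.
move=> r0 r1 h.
have cv : (fun n => b * r ^+ n) @ \oo --> b * 0.
  by apply: cvgMr; apply: cvg_expr; rewrite ger0_norm.
rewrite mulr0 in cv; apply: (ler_cvg_to (cvg_cst a) cv).
exact: nearW.
Qed.

Lemma cpowMl a b s : 0 < a -> 0 < b -> cpow (a * b) s = cpow a s * cpow b s.
Proof.
move=> a0 b0; rewrite /cpow mulf_eq0 !gt_eqF //= lnM //.
rewrite !mulrDr expRD cosD sinD; simpc; congr (_ +i* _)%C; ring.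
Qed.

Lemma cpow_expr a s n : 0 < a -> cpow (a ^+ n) s = cpow a s ^+ n.
Proof.
move=> a0; elim: n => [|n IH]; last by rewrite !exprS cpowMl ?exprn_gt0 // IH.
by rewrite !expr0 /cpow oner_eq0 ln1 !mulr0 expR0 cos0 sin0 mulr1 mul1r.
Qed.

Lemma cpowV a s : 0 < a -> cpow a^-1 s = cpow a (- s).
Proof.
move=> a0; rewrite /cpow invr_eq0 gt_eqF // lnV //.
by case: s => x y; rewrite /GRing.opp /= !mulNr !mulrN.
Qed.

Lemma cpowD a s w : 0 < a -> cpow a (s + w) = cpow a s * cpow a w.
Proof.
move=> a0; rewrite /cpow gt_eqF //; case: s w => x y [x' y'].
simpc; rewrite /= !mulrDl expRD cosD sinD; simpc; congr (_ +i* _)%C; ring.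
Qed.

Lemma cpow_mulrn a s n : 0 < a -> cpow a (s *+ n) = cpow a s ^+ n.
Proof.
move=> a0; elim: n => [|n IH]; last by rewrite mulrS cpowD // IH exprS.
by rewrite mulr0n expr0 /cpow gt_eqF //= !mul0r expR0 cos0 sin0 mulr1 mulr0.
Qed.

Lemma cpowN1 a : 0 < a -> cpow a (- 1) = ((a^-1)%:C)%C.
Proof.
move=> a0; rewrite /cpow gt_eqF //= oppr0 !mul0r cos0 sin0 mulr1 mulr0 mulN1r.
by rewrite expRN lnK.
Qed.

Lemma normc_cpow a s : 0 < a -> normc (cpow a s) = expR (complex.Re s * ln a).
Proof.
move=> a0; rewrite /cpow gt_eqF //= !exprMn -mulrDr cos2Dsin2 mulr1 sqrtr_sqr.
by rewrite ger0_norm // expR_ge0.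
Qed.

End Modulus.

Section Conductor.
Variables (R : realType) (K : nonArchLocalFieldType) (chi : K -> R[i]).
Hypothesis hchi : mult_char chi.
Local Notation normc := Normc.normc.

Lemma mult_charX u n : OKunit u -> chi (u ^+ n) = chi u ^+ n.
Proof.
have [hM h0 _ _] := hchi; move=> hu; elim: n => [|n IH]; last first.
  by rewrite !exprS hM ?IH //; exact: OKunitX.
rewrite !expr0; apply: (mulfI (h0 1 (OKunit1 K))).
by rewrite -hM ?mulr1 //; exact: OKunit1.
Qed.

(* C^* has no small subgroups: squaring moves a point of the disk of radius 1/2
   around 1 away from 1 by a factor at least 3/2. *)
Lemma mult_char_conductor : exists2 c : nat, (0 < c)%N &
  forall u, OKunit u -> ordge c (u - 1) -> chi u = 1.
Proof.
have [hM h0 _ hc] := hchi.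
have chi1 : chi 1 = 1 by have := mult_charX 0 (OKunit1 K); rewrite !expr0.
have [c c0 hnear] : exists2 c : nat, (0 < c)%N &
    forall u, OKunit u -> ordge c (u - 1) -> normc (chi u - 1) < 2^-1.
  have /subspace_continuousP/(_ 1 (OKunit1 K)) := hc.
  move=> /cvgrPdist_lt - /(_ (2^-1)%:C%C).
  rewrite ltcR invr_gt0 ltr0n => /(_ isT).
  rewrite /within /= -nbhs_entourageE => -[A].
  rewrite entourage_ord => -[N _ hN] hA.
  (* The index [N] of the entourage is an arbitrary integer; a positive exponent above it is
     needed. *)
  exists (`|N|.+1)%N => // u hu hNu.
  have Au : xsection A 1 u.
    rewrite /xsection /= inE; apply: hN => /=; move: hNu; rewrite ordgeC /ordge.
    by move=> /orP[/eqP ?|h]; [left | right; apply: le_trans h; lia].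
  have := hA u Au hu; rewrite distrC -[from_subspace _ _ 1]/(chi 1) chi1.
  by rewrite -[X in X < _]/((normc (chi u - 1))%:C%C) ltcR.
(* All u^(2^n) stay in 1 + P_K^c, so chi(u)^(2^n) stays within 1/2 of 1 although its distance to 1
   has grown by (3/2)^n; the base on the right is the inverse of 3/2. *)
have key u n : OKunit u -> ordge c (u - 1) ->
    normc (chi u - 1) <= 2^-1 * (3^-1 * 2) ^+ n.
  move=> hu hcu.
  have [vu vc] : OKunit (u ^+ (2 ^ n)) /\ ordge c (u ^+ (2 ^ n) - 1).
    split; first exact: OKunitX.
    rewrite -[X in _ - X](expr1n _ (2 ^ n)); apply: ordge_subX => //.
      exact: OKunit_ordge.
    exact: ordge01.
  have := hnear _ vu vc; rewrite mult_charX // => h.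
  have grow : (3 / 2) ^+ n * normc (chi u - 1) <= normc (chi u ^+ (2 ^ n) - 1).
    elim: (n) => [|k IH]; first by rewrite expr0 mul1r expn0 expr1.
    have uk : OKunit (u ^+ (2 ^ k)) by exact: OKunitX.
    have uck : ordge c (u ^+ (2 ^ k) - 1).
      rewrite -[X in _ - X](expr1n _ (2 ^ k)); apply: ordge_subX => //.
        exact: OKunit_ordge.
      exact: ordge01.
    have := hnear _ uk uck; rewrite mult_charX // => hk.
    set w := chi u ^+ (2 ^ k) in IH hk.
    have -> : chi u ^+ (2 ^ k.+1) - 1 = (w - 1) * (w + 1).
      by rewrite expnSr exprM -/w; ring.
    have h2 : 3 / 2 <= normc (w + 1).
      have e : normc (2 : R[i]) <= normc (w + 1) + normc (- (w - 1)).
        apply: le_trans (le_normcD _ _).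
        by rewrite [X in _ <= normc X](_ : _ = 2) //; ring.
      have e2 : normc (2 : R[i]) = 2.
        exact: normc_natr.
      rewrite normcN e2 in e; lra.
    rewrite Normc.normcM exprS mulrAC -mulrA mulrC.
    by apply: ler_pM => //; rewrite ?mulr_ge0 ?normc_ge0 ?exprn_ge0 //; lra.
  have e : (3^-1 * 2) ^+ n * (3 / 2) ^+ n = 1 :> R.
    by rewrite -exprMn (_ : 3^-1 * 2 * (3 / 2) = 1) ?expr1n //; field.
  have -> : normc (chi u - 1) = (3 / 2) ^+ n * normc (chi u - 1) * (3^-1 * 2) ^+ n.
    by rewrite mulrAC [X in X * _]mulrC e mul1r.
  apply: ler_wpM2r; first by apply: exprn_ge0; lra.
  by apply: le_trans grow _; exact: ltW.
exists c => // u hu hcu; apply/eqP; rewrite -subr_eq0; apply/eqP/Normc.eq0_normc.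
apply/eqP; rewrite eq_le normc_ge0 andbT.
apply: (@geometric_le0 _ _ 2^-1 (3^-1 * 2)); [lra|lra|] => n.
exact: key.
Qed.

End Conductor.

(** * Rationality *)

Section Rationality.
Variable R : realType.
Implicit Types (z t : R[i]) (v w : nat -> R[i]) (r : R).
Local Notation normc := Normc.normc.

(** The condition v_n = O(r^n), used for truncation errors with r = |q^-s|. *)
Definition rapid r v := exists M : R, forall n, normc (v n) <= M * r ^+ n.

Lemma rapidD r v w : rapid r v -> rapid r w -> rapid r (fun n => v n + w n).
Proof.
move=> [M hM] [N hN]; exists (M + N) => n; apply: le_trans (le_normcD _ _) _.
by rewrite mulrDl lerD.
Qed.

Lemma rapidZ r z v : rapid r v -> rapid r (fun n => z * v n).
Proof.
move=> [M hM]; exists (normc z * M) => n.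
by rewrite Normc.normcM -mulrA ler_wpM2l // normc_ge0.
Qed.

Lemma rapid_shift r a v : rapid r v -> rapid r (fun n => v (n + a)%N).
Proof.
by move=> [M hM]; exists (M * r ^+ a) => n; rewrite -mulrA -exprD addnC hM.
Qed.

(** The passage to the limit: an identity that holds up to O(r^n) for all n is exact. *)
Lemma rapid_cst r z : 0 <= r -> r < 1 -> rapid r (fun=> z) -> z = 0.
Proof.
move=> r0 r1 [M hM]; apply: Normc.eq0_normc; apply/eqP.
by rewrite eq_le normc_ge0 andbT (geometric_le0 r0 r1 hM).
Qed.

Definition partial_sum (a : nat -> R[i]) t n := \sum_(k < n) a k * t ^+ k.

Lemma partial_sum_shift L a t j :
  partial_sum (shift_seq L a) t (j + L) = t ^+ L * partial_sum a t j.
Proof.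
elim: j => [|j IH]; rewrite /partial_sum.
  rewrite add0n big_ord0 mulr0 big1 // => i _.
  by rewrite /shift_seq leqNgt ltn_ord mul0r.
rewrite addSn !big_ord_recr /= -/(partial_sum _ _ _) IH mulrDr; congr (_ + _).
by rewrite /shift_seq leq_addl addnK exprD; ring.
Qed.

Variable K : nonArchLocalFieldType.
Local Notation q := ((residue_card K)%:R : R[i]).

Lemma normc_invq_le1 : normc q^-1 <= 1.
Proof.
rewrite Normc.normcV normc_natr invf_le1 ?ler1n ?ltr0n.
  exact: ltnW (residue_card_gt1 K).
exact: ltn_trans (residue_card_gt1 K).
Qed.

Lemma eventually_geometric_sum (e : nat -> R[i]) : eventually_geometric K e ->
  exists (H : {poly R[i]}) (B : nat), forall t,
    rapid (normc t) (fun n => (1 - q^-1 * t) * partial_sum e t (n + B) - H.[t]).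
Proof.
move=> [B hB].
(* The tail from B on should sum to e_B t^B / (1 - q^-1 t), so clearing the denominator leaves the
   initial segment times 1 - q^-1 t, plus e_B t^B. The truncation error is exactly - e_B t^B (q^-1
   t)^j. *)
exists ((1 - q^-1 *: 'X) * (\sum_(k < B) e k *: 'X^k) + e B *: 'X^B), B => t.
have eB j : e (j + B)%N = q^-1 ^+ j * e B.
  by elim: j => [|j IH]; rewrite ?mul1r // addSn hB ?leq_addl // IH exprS mulrA.
exists (normc (e B * t ^+ B)) => j.
have -> : (1 - q^-1 * t) * partial_sum e t (j + B) -
   ((1 - q^-1 *: 'X) * (\sum_(k < B) e k *: 'X^k) + e B *: 'X^B).[t] =
   - (e B * t ^+ B * (q^-1 * t) ^+ j).
  rewrite !hornerE horner_sum.
  have -> : \sum_(k < B) (e k *: 'X^k).[t] = partial_sum e t B.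
    by apply: eq_bigr => k _; rewrite !hornerE.
  elim: j => [|j IH]; first by rewrite expr0 mulr1 add0n opprD addrA subrr add0r.
  rewrite addSn /partial_sum big_ord_recr /= -/(partial_sum _ _ _) mulrDr addrAC.
  by rewrite IH eB exprD exprS exprMn; ring.
rewrite normcN Normc.normcM ler_wpM2l ?normc_ge0 // normcX Normc.normcM.
rewrite lerXn2r ?nnegrE ?mulr_ge0 ?normc_ge0 //.
by rewrite -[leRHS]mul1r ler_wpM2r ?normc_ge0 ?normc_invq_le1.
Qed.

(** The hypothesis says that 1 - l t^L times the series is eventually geometric. [H] is chosen
    before [t] and [z], since one polynomial has to serve all s. *)
Lemma rational_of_recurrence (a : nat -> R[i]) (l : R[i]) (L : nat) :
  eventually_geometric K (fun k => a k - l * shift_seq L a k) ->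
  exists H : {poly R[i]}, forall t z, normc t < 1 ->
    rapid (normc t) (fun n => z - partial_sum a t n) ->
    (1 - q^-1 * t) * (1 - l * t ^+ L) * z = H.[t].
Proof.
move=> /eventually_geometric_sum[H [B hH]]; exists H => t z t1 hz.
apply/eqP; rewrite -subr_eq0; apply/eqP; apply: (rapid_cst (normc_ge0 t) t1).
(* The offsets align the truncations: the partial sum of length n + L + B of the shifted sequence is
   t^L times that of length n + B of the original. *)
have := rapidD (rapidZ (1 - q^-1 * t) (rapidD (rapid_shift (L + B) hz)
  (rapidZ (- (l * t ^+ L)) (rapid_shift B hz)))) (rapid_shift L (hH t)).
case=> M hM; exists M => n; apply: le_trans (hM n).
rewrite le_eqVlt; apply/orP; left; apply/eqP; congr normc.
have -> : partial_sum (fun k => a k - l * shift_seq L a k) t (n + L + B) =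
    partial_sum a t (n + (L + B)) - l * (t ^+ L * partial_sum a t (n + B)).
  rewrite -partial_sum_shift (_ : n + B + L = n + (L + B))%N; last by lia.
  rewrite addnA /partial_sum mulr_sumr -sumrB; apply: eq_bigr => k _.
  by rewrite mulrBl mulrA.
ring.
Qed.

End Rationality.

(** * From means to the Haar integral *)

Section Integral.
Variables (R : realType) (K : nonArchLocalFieldType) (pi : K) (hpi : uniformizer pi).
Variable mu : {measure set (borelKn K 2) -> \bar R}.
Hypothesis hmu : normalized_haar mu.
Local Notation normc := Normc.normc.
Local Notation z0 z := ((z : 'rV[K]_2) ord0 ord0).
Local Notation z1 z := ((z : 'rV[K]_2) ord0 ord_max).
Local Notation mean := (mean pi (C := R[i])).

(** The [T n] converge to [f] uniformly on O_K^2, which makes [f] measurable; the case n = 0, where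
    [T] vanishes, bounds it by M. As the total mass is 1, the uniform error also bounds the error of
    the integrals. *)
Lemma Rintegral_approx (f : borelKn K 2 -> R) (T : nat -> K -> K -> R)
    (N : nat -> nat) M r :
  0 <= r -> r < 1 -> (forall n, level2 (N n) (T n)) ->
  (forall x y, T 0%N x y = 0) ->
  (forall z n, @OKn K 2 z -> `|f z - T n (z0 z) (z1 z)| <= M * r ^+ n) ->
  forall n, `|Rintegral mu (@OKn K 2) f - (residue_card K)%:R^-1 ^+ N n *
    ((residue_card K)%:R^-1 ^+ N n * \sum_(x <- representatives pi (N n))
      \sum_(y <- representatives pi (N n)) T n x y)| <= M * r ^+ n.
Proof.
move=> r0 r1 hT T0 hf n; have mD := @measurable_OKn K.
have mT k : measurable_fun (@OKn K 2) (fun z : borelKn K 2 => T k (z0 z) (z1 z)).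
  exact: (measurable_level2 hpi (hT k)).
have mf : measurable_fun (@OKn K 2) f.
  apply: (measurable_fun_cvg mT) => z hz; apply/cvgrPdist_le => e e0.
  have cv : (fun k => M * r ^+ k) @ \oo --> M * 0.
    by apply: cvgMr; apply: cvg_expr; rewrite ger0_norm.
  rewrite mulr0 in cv; move/cvgrPdist_le: cv => /(_ e e0); apply: filterS => k.
  rewrite sub0r normrN; apply: le_trans; apply: le_trans (hf z k hz) _; exact: ler_norm.
have bf z : @OKn K 2 z -> `|f z| <= M.
  by move=> hz; have := hf z 0%N hz; rewrite T0 subr0 expr0 mulr1.
have intf := integrable_bounded hmu mf bf.
have intT : mu.-integrable (@OKn K 2)
    (EFin \o (fun z : borelKn K 2 => T n (z0 z) (z1 z))).
  apply: (integrable_bounded hmu (M := M + M * r ^+ n)) => // z hz.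
  rewrite -[T n _ _](subrK (f z)); apply: le_trans (ler_normD _ _) _.
  by rewrite addrC lerD ?bf // distrC hf.
rewrite mulrA -(fine_haar_box hpi hmu) -(Rintegral_level2_box hpi hmu (hT n)).
rewrite -RintegralB //.
apply: le_trans (le_normr_Rintegral _ _) _ => //.
  by apply: eq_integrable (integrableB mD intf intT).
have -> : M * r ^+ n = Rintegral mu (@OKn K 2) (fun=> M * r ^+ n).
  by rewrite Rintegral_cst // hmu.2 /= mulr1.
apply: le_Rintegral => //.
- apply: (integrable_bounded hmu (M := M * r ^+ n)) => [|z hz].
    by apply: measurableT_comp => //; exact: measurable_funB.
  by rewrite normr_id hf.
- apply: (integrable_bounded hmu (M := `|M * r ^+ n|)) => [|z hz //].
  exact: measurable_cst.
- by move=> z hz; exact: hf.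
Qed.

Lemma ReD (a b : R[i]) : complex.Re (a + b) = complex.Re a + complex.Re b.
Proof. by case: a b => [? ?] [? ?]. Qed.

Lemma ImD (a b : R[i]) : complex.Im (a + b) = complex.Im a + complex.Im b.
Proof. by case: a b => [? ?] [? ?]. Qed.

Lemma invq_real n : ((residue_card K)%:R : R[i])^-1 ^+ n =
  ((((residue_card K)%:R : R)^-1 ^+ n)%:C)%C.
Proof. by rewrite rmorphXn fmorphV rmorph_nat. Qed.

Lemma ReZ (a : R) (b : R[i]) : complex.Re (a%:C%C * b) = a * complex.Re b.
Proof. by case: b => x y; simpc. Qed.

Lemma ImZ (a : R) (b : R[i]) : complex.Im (a%:C%C * b) = a * complex.Im b.
Proof. by case: b => x y; simpc. Qed.

(** Real and imaginary parts are estimated separately, whence M + M. *)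
Lemma Cintegral_approx (F : borelKn K 2 -> R[i]) (T : nat -> K -> K -> R[i])
    (N : nat -> nat) M r :
  0 <= r -> r < 1 -> (forall n, level2 (N n) (T n)) ->
  (forall x y, T 0%N x y = 0) ->
  (forall z n, @OKn K 2 z -> normc (F z - T n (z0 z) (z1 z)) <= M * r ^+ n) ->
  forall n, normc (Cintegral mu (@OKn K 2) F - mean (fun x => mean (T n x))) <=
    (M + M) * r ^+ n.
Proof.
move=> r0 r1 hT T0 hF n.
have hRe := @Rintegral_approx (fun z => complex.Re (F z))
  (fun k x y => complex.Re (T k x y)) N M r r0 r1 _ _ _ n.
have hIm := @Rintegral_approx (fun z => complex.Im (F z))
  (fun k x y => complex.Im (T k x y)) N M r r0 r1 _ _ _ n.
apply: le_trans (normc_le_ReIm _) _; rewrite mulrDl (mean2E hpi (hT n)) !invq_real.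
have ReN (b : R[i]) : complex.Re (- b) = - complex.Re b by case: b.
have ImN (b : R[i]) : complex.Im (- b) = - complex.Im b by case: b.
rewrite ReD ImD ReN ImN !ReZ !ImZ.
have Re_sum := @big_morph _ _ (@complex.Re R) 0 +%R 0 +%R ReD erefl.
have Im_sum := @big_morph _ _ (@complex.Im R) 0 +%R 0 +%R ImD erefl.
rewrite !Re_sum !Im_sum.
apply: lerD.
- under [X in _ - _ * (_ * X)]eq_bigr do rewrite Re_sum.
  apply: hRe => [k x x' y y' hx hx' hy hy' xx yy|x y|z k hz].
  + by congr complex.Re; exact: hT.
  + by rewrite T0.
  + by rewrite -ReN -ReD; apply: le_trans (normr_Re_le _) (hF z k hz).
- under [X in _ - _ * (_ * X)]eq_bigr do rewrite Im_sum.
  apply: hIm => [k x x' y y' hx hx' hy hy' xx yy|x y|z k hz].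
  + by congr complex.Im; exact: hT.
  + by rewrite T0.
  + by rewrite -ImN -ImD; apply: le_trans (normr_Im_le _) (hF z k hz).
Qed.

End Integral.

(** * The zeta integral as a power series in q^-s *)

Section Zeta.
Variables (R : realType) (K : nonArchLocalFieldType) (pi : K) (hpi : uniformizer pi).
Variable mu : {measure set (borelKn K 2) -> \bar R}.
Hypothesis hmu : normalized_haar mu.
Variable chi : K -> R[i].
Hypothesis hchi : mult_char chi.
Local Notation normc := Normc.normc.
Local Notation z0 z := ((z : 'rV[K]_2) ord0 ord0).
Local Notation z1 z := ((z : 'rV[K]_2) ord0 ord_max).
Local Notation qR := ((residue_card K)%:R : R).

(** On units [chi] depends only on the class modulo P_K^c. The sum over all representatives,
    non-units included, dominates each of these finitely many values. *)
Lemma mult_char_bounded : exists M : R, forall u, OKunit u -> normc (chi u) <= M.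
Proof.
have [hM _ _ _] := hchi; have [c c0 chi1] := mult_char_conductor hchi.
exists (\sum_(r <- representatives pi c) normc (chi r)) => u hu.
have [r hr h] := representativesP hpi c (OKunit_ordge hu).
have hru : OKunit r.
  by apply: (OKunit_near hu); rewrite ordgeC; apply: ordgeW h; lia.
rewrite (bigD1_seq r) //=; last exact: uniq_representatives.
have -> : chi u = chi r.
  have e : u = u / r * r by rewrite divfK ?hru.1.
  rewrite {1}e hM //; last by apply: OKunitM => //; exact: OKunitV.
  rewrite chi1 ?mul1r //; first by apply: OKunitM => //; exact: OKunitV.
  rewrite -(divff hru.1) -mulrBl; apply: ordgeMr => //.
  exact/OKunit_ordge/OKunitV.
by rewrite lerDl; apply: sumr_ge0 => *; exact: normc_ge0.
Qed.

Lemma qR_gt1 : 1 < qR. Proof. by rewrite ltr1n residue_card_gt1. Qed.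

Lemma qR_gt0 : 0 < qR. Proof. exact: lt_trans qR_gt1. Qed.

Lemma cpow_absK (w : K) (s : R[i]) k : w != 0 -> ord w = k%:Z ->
  cpow (absK R w) s = cpow qR (- s) ^+ k.
Proof.
move=> w0 ow; rewrite /absK (negPf w0) ow -exprnN -exprVn cpow_expr ?invr_gt0 ?qR_gt0 //.
by rewrite cpowV ?qR_gt0.
Qed.

Lemma normc_cpow_lt1 (s : R[i]) : 0 < complex.Re s -> normc (cpow qR (- s)) < 1.
Proof.
move=> s0; rewrite normc_cpow ?qR_gt0 // -[X in _ < X](expR0 R) ltr_expR.
have -> : complex.Re (- s) = - complex.Re s by case: (s).
by rewrite mulNr oppr_lt0; apply: mulr_gt0 => //; apply: ln_gt0; exact: qR_gt1.
Qed.

(** Only the term k = ord w of the sum can be nonzero. If ord w < n it equals the integrand;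
    otherwise the sum is 0 and the integrand is at most M |t|^(ord w). At w = 0 both vanish, because
    chi 0 = 0. *)
Lemma chi_cpow_approx (w : K) (s : R[i]) (n : nat) M :
  ordge 0 w -> 0 < complex.Re s -> 0 <= M ->
  (forall u, OKunit u -> normc (chi u) <= M) ->
  normc (chi (ac pi w) * cpow (absK R w) s -
     \sum_(k < n) char_coef pi chi k w * cpow qR (- s) ^+ k) <=
  M * normc (cpow qR (- s)) ^+ n.
Proof.
move=> hw s0 M0 hM; set t := cpow qR (- s).
have t0 : 0 <= normc t by exact: normc_ge0.
have t1 : normc t <= 1 by exact/ltW/normc_cpow_lt1.
have [_ _ chi0 _] := hchi.
have [e|w0] := eqVneq w 0.
  rewrite e /ac mul0r chi0 mul0r big1 => [|k _].
    by rewrite subrr Normc.normc0 mulr_ge0 // exprn_ge0.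
  by rewrite /char_coef eqxx mul0r.
have [k ok] : exists k : nat, ord w = k.
  by move: hw; rewrite ordgeE //; case: (ord w) => // k _; exists k.
rewrite (cpow_absK s w0 ok) -/t.
have [kn|nk] := ltnP k n.
  rewrite (bigD1 (Ordinal kn)) //= big1 => [|i ik].
    by rewrite /char_coef w0 ok eqxx addr0 subrr Normc.normc0 mulr_ge0 // exprn_ge0.
  rewrite char_coef_ord ?mul0r // ok eqz_nat; apply: contra ik => /eqP e.
  by apply/eqP/val_inj.
rewrite big1 => [|i _]; last first.
  rewrite char_coef_ord ?mul0r // ok eqz_nat; apply/eqP => e.
  by have := ltn_ord i; lia.
rewrite subr0 Normc.normcM normcX; apply: ler_pM => //.
- exact: normc_ge0.
- exact: exprn_ge0.
- by apply: hM; exact: ac_unit.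
- exact: ler_wiXn2l.
Qed.

Variables (c : nat) (c0 : (0 < c)%N).
Hypothesis chi1 : forall u, OKunit u -> ordge c (u - 1) -> chi u = 1.
Variables (m : nat) (mu2 : K) (mu2_int : ordge 0 mu2) (d : nat) (u : K -> K).
Hypothesis hu : unit_lipschitz u.

(** The pointwise truncation [T n] is a step function whose mean is the n-th partial sum by
    linearity, and its uniform error passes to the integral. *)
Lemma zeta_partial_sums (s : R[i]) : 0 < complex.Re s ->
  let h x y := x ^+ d * u x + mu2 * y ^+ m in
  let t := cpow qR (- s) in
  rapid (normc t) (fun n => Cintegral mu (@OKn K 2)
    (fun z => chi (ac pi (h (z0 z) (z1 z))) * cpow (absK R (h (z0 z) (z1 z))) s) -
    partial_sum (coef_seq pi chi m mu2 d u) t n).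
Proof.
move=> s0 h t; have [chiM _ _ _] := hchi.
have [M hM] := mult_char_bounded.
have M0 : 0 <= M by apply: le_trans (normc_ge0 (chi 1)) (hM 1 (OKunit1 K)).
exists (M + M) => n.
pose T n x y := \sum_(k < n) char_coef pi chi k (h x y) * t ^+ k.
have lT k : level2 (k + c) (T k).
  move=> x x' y y' hx hx' hy hy' xx yy; apply: eq_bigr => i _; congr (_ * _).
  apply: (level2_char_coef hpi c0 chiM chi1 m mu2_int d hu) => //.
    by apply: ordgeW xx; have := ltn_ord i; lia.
  by apply: ordgeW yy; have := ltn_ord i; lia.
have -> : partial_sum (coef_seq pi chi m mu2 d u) t n =
    mean pi (fun x => mean pi (T n x)).
  elim: n => [|k IH].
    rewrite /partial_sum big_ord0 -[LHS](mean_cst hpi); apply: (eq_mean hpi) => [|x hx].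
      exact: loc_const_mean (lT 0%N).
    rewrite -[LHS](mean_cst hpi); apply: (eq_mean hpi) => [|y hy].
      by eexists; exact: level2l (lT 0%N) hx.
    by rewrite /T big_ord0.
  have lk : level2 (k + c) (fun x y => char_coef pi chi k (h x y)).
    exact: level2_char_coef.
  rewrite /partial_sum big_ord_recr /= -/(partial_sum _ _ _) IH mulrC.
  rewrite /coef_seq -(meanZ hpi); last exact: loc_const_mean lk.
  rewrite -(meanD hpi); first last.
  - by have [j hj] := loc_const_mean hpi lk; exists j => x y hx hy e; rewrite (hj x y).
  - exact: loc_const_mean (lT k).
  apply: (eq_mean hpi) => [|x hx]; first exact: loc_const_mean (lT k.+1).
  have lx := level2l lk hx; have lTx := level2l (lT k) hx.
  rewrite -(meanZ hpi); last by eexists; exact: lx.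
  rewrite -(meanD hpi); first last.
  - by exists (k + c)%N => y y' hy hy' e; rewrite (lx y y').
  - by eexists; exact: lTx.
  apply: (eq_mean hpi) => [|y hy]; first by eexists; exact: level2l (lT k.+1) hx.
  by rewrite /T big_ord_recr /= [_ * t ^+ k]mulrC.
apply: (Cintegral_approx hpi hmu (normc_ge0 t) (normc_cpow_lt1 s0) lT).
  by move=> x y; rewrite /T big_ord0.
move=> z k hz; apply: chi_cpow_approx => //.
have hz0 : ordge 0 (z0 z) by apply/OK_ordge; exact: hz.
have hz1 : ordge 0 (z1 z) by apply/OK_ordge; exact: hz.
by apply: ordgeD; [apply: ordge_pow_unit => //; exact: hu.1 | rewrite ordgeMl ?ordgeX].
Qed.

End Zeta.

(** * The polynomial h *)

Section Curve.
Variables (K : nonArchLocalFieldType) (pi : K) (hpi : uniformizer pi).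

(** Bezout gives 1 + a m = 0 in K, so m and -a are inverse to each other; both have nonnegative
    valuation, hence valuation 0. *)
Lemma OKunit_natr p m : p \in [pchar K] -> ~~ (p %| m)%N -> OKunit (m%:R : K).
Proof.
move=> hp hpm; have pp := pcharf_prime hp.
have m0 : (m%:R : K) != 0 by rewrite -(dvdn_pcharf hp).
have [a _] := Bezoutl m (prime_gt0 pp).
rewrite (eqP (_ : coprime p m)) ?prime_coprime // (dvdn_pcharf hp) natrD natrM => /eqP e.
have e1 : - a%:R * m%:R = 1 :> K.
  by apply/eqP; rewrite mulNr -subr_eq0 -opprD oppr_eq0 addrC e.
have a0 : - a%:R != 0 :> K.
  by apply/eqP => a0; move: e1; rewrite a0 mul0r => /esym/eqP; rewrite oner_eq0.
have := ord_mul a0 m0; rewrite e1 ord1 => eo.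
have h1 : ordge 0 (- a%:R : K) by rewrite ordgeN ordge_natr.
have h2 := ordge_natr K m; rewrite ordgeE // in h1; rewrite ordgeE // in h2.
by split=> //; lia.
Qed.

Lemma meval_hpoly (mu1 mu2 : K) d m (h0 : {poly K}) (v : 'I_2 -> K) :
  mpoly.meval v (hpoly pi mu1 mu2 d m h0) =
  mu1 * v ord0 ^+ d + mu2 * v ord_max ^+ m + pi * h0.[v ord0].
Proof.
rewrite /hpoly !mpoly.mevalD !mpoly.mevalZ !rmorphXn /= !mpoly.mevalXU.
congr (_ + _ * _).
rewrite -(horner_map (mpoly.meval v)) /= mpoly.mevalXU -map_poly_comp map_poly_id //.
by move=> a _ /=; rewrite mpoly.mevalC.
Qed.

Variables (mu1 : K) (hmu1 : OKunit mu1) (k0 : {poly K}).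
Hypothesis hk0 : forall i : nat, ordge 0 k0`_i.

(** The cofactor of x^d in mu1 x^d + pi h0(x) when h0 = k0 x^(d+1). The explicit factor x, which
    comes from ldeg(h0) >= d + 1, makes it tend to [mu1] at 0. *)
Definition unit_factor (x : K) : K := mu1 + pi * (x * k0.[x]).

Lemma ordge_horner x : ordge 0 x -> ordge 0 k0.[x].
Proof.
by move=> hx; rewrite horner_coef; apply: ordge_sum => i _; rewrite ordgeMl ?ordgeX.
Qed.

Lemma ordge_horner_sub n x y : ordge 0 x -> ordge 0 y -> ordge n (x - y) ->
  ordge n (k0.[x] - k0.[y]).
Proof.
move=> hx hy h; rewrite !horner_coef -sumrB; apply: ordge_sum => i _.
by rewrite -mulrBr ordgeMl // ordge_subX.
Qed.

Lemma ordge_mul_sub n (x y a b : K) : ordge 0 y -> ordge 0 a -> ordge n (x - y) ->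
  ordge n (a - b) -> ordge n (x * a - y * b).
Proof.
move=> hy ha h h'; rewrite -(subrKA (y * a)) -mulrBl -mulrBr.
by apply: ordgeD; [exact: ordgeMr | exact: ordgeMl].
Qed.

Lemma unit_lipschitz_unit_factor : unit_lipschitz unit_factor.
Proof.
split=> [x hx|x y n hx hy h].
  apply: (OKunit_near hmu1); rewrite /unit_factor addrAC subrr add0r.
  by rewrite ordge_pi1M // ordgeMl // ordge_horner.
rewrite /unit_factor opprD addrACA subrr add0r -mulrBr; apply: ordgeMl.
  exact: ordge0_pi.
by apply: ordge_mul_sub => //; [exact: ordge_horner | exact: ordge_horner_sub].
Qed.

Lemma unit_factor_deep (j : nat) x : ordge 0 x ->
  ordge j (unit_factor (pi ^+ j * x) - mu1).
Proof.
move=> hx; rewrite /unit_factor addrAC subrr add0r; apply: ordgeMl.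
  exact: ordge0_pi.
have hj : ordge j (pi ^+ j * x) by rewrite ordge_piM // subrr.
apply: ordgeMr => //; apply: ordge_horner; apply: ordgeW hj; lia.
Qed.

(** Modulo [pi] the map is multiplication by [mu1]: in a difference of two values, mu1 (x - y) has
    strictly smaller valuation than the remainder. *)
Lemma isometric_unit_factor : isometric (fun x => x * unit_factor x).
Proof.
have hu := unit_lipschitz_unit_factor.
split=> [x hx|x y j hx hy]; first by rewrite ordgeMl //; apply/OKunit_ordge/hu.1.
have -> : x * unit_factor x - y * unit_factor y =
    mu1 * (x - y) + pi * (x * (x * k0.[x]) - y * (y * k0.[y])).
  by rewrite /unit_factor; ring.
have [->|xy] := eqVneq x y; first by rewrite !subrr !mulr0 addr0.
have xy0 : x - y != 0 by rewrite subr_eq0.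
have [n on] : exists n : nat, ord (x - y) = n.
  have : ordge 0 (x - y) by exact: ordgeB.
  by rewrite ordgeE //; case: (ord _) => // n _; exists n.
have hn : ordge n (x - y) by rewrite ordgeE // on.
have [mu10 omu1] := hmu1.
have h2 : ordge (n%:Z + 1) (pi * (x * (x * k0.[x]) - y * (y * k0.[y]))).
  rewrite ordge_pi1M // addrK; apply: ordge_mul_sub => //.
    by rewrite ordgeMl ?ordge_horner.
  by apply: ordge_mul_sub => //; [exact: ordge_horner | exact: ordge_horner_sub].
have o1 : ord (mu1 * (x - y)) = n by rewrite ord_mul // omu1 add0r.
have nz1 : mu1 * (x - y) != 0 by exact: mulf_neq0.
have lt1 : ord (mu1 * (x - y)) < n%:Z + 1 by rewrite o1; lia.
have [nz o] := ord_addl nz1 lt1 h2.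
by rewrite !ordgeE // o o1 on.
Qed.

Lemma hpoly_factor (mu2 : K) d m (h0 : {poly K}) (x y : K) :
  h0 = k0 * 'X^(d.+1) ->
  mu1 * x ^+ d + mu2 * y ^+ m + pi * h0.[x] = x ^+ d * unit_factor x + mu2 * y ^+ m.
Proof. by move=> ->; rewrite /unit_factor hornerM hornerXn exprS; ring. Qed.

End Curve.

(** The coefficients of index at most d vanish; this includes h0 = 0, where [ldeg] is infinite. *)
Lemma ldeg_factor (K : fieldType) (h0 : {poly K}) d :
  (((d.+1)%:Z)%:E <= ldeg h0)%E -> h0 = drop_poly d.+1 h0 * 'X^(d.+1).
Proof.
move=> h; rewrite -[LHS](poly_take_drop d.+1) (_ : take_poly _ _ = 0) ?add0r //.
apply/polyP => i; rewrite coef_take_poly coef0; case: ltnP => // hi.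
move: h; rewrite /ldeg; case: eqVneq => [->|nz]; first by rewrite coef0.
rewrite lee_fin lez_nat => h; apply/eqP; apply/negPn/negP => hne.
by have := @before_find _ 0 (fun a : K => a != 0) h0 i (leq_trans hi h); rewrite hne.
Qed.

Lemma one_sub_neq0 (R : realType) (z : R[i]) : Normc.normc z < 1 -> 1 - z != 0.
Proof.
apply: contraTneq => /eqP; rewrite subr_eq0 => /eqP <-.
by rewrite Normc.normc1 ltxx.
Qed.

Theorem theorem1p1 (R : realType) (K : nonArchLocalFieldType) (p : nat)
    (hp : p \in [pchar K]) (pi : K) (hpi : uniformizer pi)
    (mu : {measure set (borelKn K 2) -> \bar R}) (hmu : normalized_haar mu)
    (m d : nat) (hm : (2 <= m)%N) (hpm : ~~ (p %| m)%N)
    (mu1 mu2 : K) (hmu1 : OKunit mu1) (hmu2 : OK mu2) (hmu2_neq0 : mu2 != 0)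
    (h0 : {poly K}) (hh0 : forall i : nat, OK h0`_i)
    (hldeg : (((d.+1)%:Z)%:E <= ldeg h0)%E)
    (chi : K -> R[i]) (hchi : mult_char chi) :
  let h := hpoly pi mu1 mu2 d m h0 in
  let q : R := (residue_card K)%:R in
  let g := gcdn d m in
  let d' := (d %/ g)%N in
  let m' := (m %/ g)%N in
  exists H1 H2 : {poly R[i]}, forall s : R[i], 0 < complex.Re s ->
    igusa_zeta pi mu h chi s =
      if (d <= 1)%N then H1.[cpow q (- s)] / (1 - cpow q (- 1 - s))
      else H2.[cpow q (- s)] /
           ((1 - cpow q (- 1 - s)) *
            (1 - cpow q (- d'%:R - m'%:R - (d' * m' * g)%:R * s))).
Proof.
move=> h q g d' m'.
have [c c0 chi1] := mult_char_conductor hchi; have [chiM _ _ _] := hchi.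
have m_gt0 : (0 < m)%N by apply: leq_trans hm.
have hmK := OKunit_natr hp hpm.
have mu2i : ordge 0 mu2 by apply/OK_ordge.
pose k0 := drop_poly d.+1 h0.
have hk0 i : ordge 0 k0`_i by rewrite coef_drop_poly; apply/OK_ordge.
pose u := unit_factor pi mu1 k0.
have hu : unit_lipschitz u by exact: unit_lipschitz_unit_factor.
pose a := coef_seq pi chi m mu2 d u.
have approx s : 0 < complex.Re s -> rapid (Normc.normc (cpow q (- s)))
    (fun n => igusa_zeta pi mu h chi s - partial_sum a (cpow q (- s)) n).
  move=> s0; have := zeta_partial_sums hpi hmu hchi c0 chi1 m mu2i d hu s0.
  congr (rapid _ _); apply/funext => n; congr (Cintegral _ _ _ - _).
  apply/funext => z; rewrite meval_hpoly.
  by rewrite (hpoly_factor pi mu1 _ _ _ _ (ldeg_factor hldeg)).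
have qt s : cpow q (- 1 - s) = (residue_card K)%:R^-1 * cpow q (- s).
  by rewrite cpowD ?qR_gt0 // cpowN1 ?qR_gt0 // fmorphV rmorph_nat.
have nt s : 0 < complex.Re s -> Normc.normc (cpow q (- s)) < 1.
  exact: normc_cpow_lt1.
have invq_le1 := normc_invq_le1 R K.
have nqt s : 0 < complex.Re s -> 1 - (residue_card K)%:R^-1 * cpow q (- s) != 0.
  move=> s0; apply: one_sub_neq0; rewrite Normc.normcM.
  apply: le_lt_trans (nt s s0); rewrite -[leRHS]mul1r.
  by apply: ler_wpM2r => //; exact: normc_ge0.
have [d_le1|d_gt1] := leqP d 1.
  (* With l = 0 the recurrence says that the sequence itself is eventually geometric, and only the
     factor 1 - q^-1 t remains. *)
  have geo : eventually_geometric K (fun k => a k - 0 * shift_seq 0 a k).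
    have : eventually_geometric K a.
      rewrite /a; case: (d) d_le1 => [|[|//]] _.
        exact: (coef_seq0 hpi c0 chiM chi1 m_gt0 hmK hmu2_neq0 mu2i hu).
      apply: (coef_seq1 hpi c0 chiM chi1 m mu2i hu).
      exact: isometric_unit_factor.
    by case=> B hB; exists B => k hk; rewrite !mul0r !subr0 hB.
  have [H hH] := rational_of_recurrence geo.
  exists H, 0 => s s0; rewrite -(hH _ _ (nt s s0) (approx s s0)) mul0r subr0 mulr1 qt.
  by rewrite mulrAC divff ?mul1r // nqt.
have g_gt0 : (0 < g)%N by rewrite gcdn_gt0 m_gt0 orbT.
have ed : (d = d' * g)%N by rewrite divnK // dvdn_gcdl.
have em : (m = m' * g)%N by rewrite divnK // dvdn_gcdr.
have m'_gt0 : (0 < m')%N by case: (m') em => //; rewrite mul0n => e; rewrite e in m_gt0.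
pose L := (d' * m' * g)%N.
have Ld : (m' * d = L)%N by rewrite {1}ed /L; lia.
have Lm : (d' * m = L)%N by rewrite {1}em /L; lia.
(* After c scalings by [pi] the factor is constant modulo P_K^c, so the induction on j is entered at
   j = c. *)
have deep x : ordge 0 x -> ordge c (u (pi ^+ c * x) - mu1).
  exact: unit_factor_deep.
have geo := coef_seq_rational hpi c0 chiM chi1 m_gt0 hmK hmu2_neq0 mu2i
  Ld Lm m'_gt0 hp hpm hmu1 hu deep.
have [H hH] := rational_of_recurrence geo.
exists 0, H => s s0; rewrite -(hH _ _ (nt s s0) (approx s s0)) qt.
have natN n : - n%:R = (- 1 : R[i]) *+ n by rewrite mulNrn.
(* With t = q^-s, the exponents split so that the second factor of the denominator becomes 1 -
   q^-(m'+d') t^L. *)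
have -> : cpow q (- d'%:R - m'%:R - (d' * m' * g)%:R * s) =
    (residue_card K)%:R^-1 ^+ (m' + d') * cpow q (- s) ^+ L.
  rewrite !cpowD ?qR_gt0 // !natN !cpow_mulrn ?qR_gt0 // cpowN1 ?qR_gt0 //.
  rewrite mulr_natl -mulNrn cpow_mulrn ?qR_gt0 // fmorphV rmorph_nat exprD.
  by rewrite [X in X * _ = _]mulrC.
(* Since L > 0 and |t| < 1, this factor is nonzero, so the polynomial identity for [H] can be
   divided by it. *)
have nl : 1 - (residue_card K)%:R^-1 ^+ (m' + d') * cpow q (- s) ^+ L != 0.
  have t1 := nt s s0; apply: one_sub_neq0; rewrite Normc.normcM !normcX.
  have L_gt0 : (0 < L)%N by rewrite -Ld muln_gt0 m'_gt0 ltnW.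
  apply: (@le_lt_trans _ _ (1 * Normc.normc (cpow q (- s)) ^+ L)).
    by apply: ler_wpM2r; [apply: exprn_ge0 | apply: exprn_ile1]; rewrite ?normc_ge0.
  by rewrite mul1r exprn_ilt1 ?normc_ge0 // -lt0n.
by rewrite [RHS]mulrAC divff ?mul1r // mulf_neq0 // nqt.
Qed.
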